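(* Let $\mathcal A\subseteq\overline{\mathcal P}_2$ be geodesically convex with $\bar\delta_0\in\mathcal A$, let $\lambda>0$, and let the velocity field $v$ be $\lambda$-monotone in $\mathcal A$. Suppose that: (i) (differentiability) for all $\rho\in\mathcal A$, the terms $J_1[\rho]$ and $J_2[\rho]$ are well-defined for $\rho$-a.e. $x$; (ii) (continuity) if $\rho_\varepsilon\to\bar\rho$ in $\overline{\mathscr W}_2$ as $\varepsilon\to0$ with $\rho_\varepsilon,\bar\rho\in\mathcal A$, then for any $w\in L^2(\bar\rho)$, $$\iint\langle w(x),J_2[\rho_\varepsilon](x+\varepsilon w(x),\hat x+\varepsilon w(\hat x))\,w(\hat x)\rangle\,\mathrm d\bar\rho(x)\mathrm d\bar\rho(\hat x)+\int\langle w(x),J_1[\rho_\varepsilon](x+\varepsilon w(x))\,w(x)\rangle\,\mathrm d\bar\rho(x)$$ $$\longrightarrow\ \iint\langle w(x),J_2[\bar\rho](x,\hat x)\,w(\hat x)\rangle\,\mathrm d\bar\rho(x)\mathrm d\bar\rho(\hat x)+\int\langle w(x),J_1[\bar\rho](x)\,w(x)\rangle\,\mathrm d\bar\rho(x)\quad\text{as }\varepsilon\to0;$$ (iii) (admissible velocity fields) $v_i[\rho]\in Y_i(\rho_i,\mathcal A_i)$ for all $\rho\in\mathcal A$ and all $i$. Let $\rho(t)\in\mathcal A$, $t\ge0$, evolve according to $\partial_t\rho_i+\mathrm{div}(\rho_iv_i[\rho])=0$ for all $i\in\{1,\dots,n\}$. If $\|v[\bar\delta_0](0)\|<\infty$,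 $D(\rho(0))<\infty$, and for all $\rho\in\mathcal A$ and all $i$ the velocity fields satisfy $\nabla_{x_i}v_i[\rho]\in L^\infty_{loc}(\mathbb R^{d_i};\mathbb R^{d_i}\times\mathbb R^{d_i})$, then there exists $c\in\mathbb R_+$ such that $M(\rho(t))\le c$ for all $t\ge0$.
   Context: Fix $n\ge 1$ and dimensions $d_1,\dots,d_n$, $d=\sum_{i=1}^n d_i$; write $x=[x_1,\dots,x_n]\in\mathbb R^d$ with $x_i\in\mathbb R^{d_i}$. $\mathcal P_2(\mathbb R^k)$ is the set of Borel probability measures on $\mathbb R^k$ with finite second moment, $\mathscr W_2$ is the Wasserstein-2 metric, $\overline{\mathcal P}_2=\mathcal P_2(\mathbb R^{d_1})\times\cdots\times\mathcal P_2(\mathbb R^{d_n})$, with elements $\rho=[\rho_1,\dots,\rho_n]$, metrized by $\overline{\mathscr W}_2(\rho,\mu)^2=\sum_{i=1}^n\mathscr W_2(\rho_i,\mu_i)^2$. $\mathcal A_i\subseteq\mathcal P_2(\mathbb R^{d_i})$ denotes the $i$-th factor of $\mathcal A=\mathcal A_1\times\cdots\times\mathcal A_n$. $\bar\delta_0=[\delta_0,\dots,\delta_0]$ is the vector of Dirac masses at the origin. $M(\rho)=\frac12\sum_{i=1}^n\int\|x_i\|^2\,\mathrm d\rho_i(x_i)$ and $D(\rho)=\frac12\sum_{i=1}^n\int\|v_i[\rho](x_i)\|^2\,\mathrm d\rho_i(x_i)$. $\Gamma_i^*(\rho_i,\mu_i)$ is the set of optimal couplings (for the cost $\|x_i-y_i\|^2$)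 of $\rho_i$ and $\mu_i$; $\Gamma^*(\rho,\mu)=\prod_i\Gamma_i^*(\rho_i,\mu_i)$, with $(\gamma_1,\dots,\gamma_n)$ identified with the product measure $\mathrm d\gamma(x,y)=\prod_i\mathrm d\gamma_i(x_i,y_i)$; $\mathrm d\rho(x)=\prod_i\mathrm d\rho_i(x_i)$. Geodesics are $\rho^{(s)}_i=((1-s)x_i+sy_i)_\sharp\gamma_i$, $s\in[0,1]$, $\gamma\in\Gamma^*(\rho^{(0)},\rho^{(1)})$. Vector fields such as $w$ are of the form $w(x)=[w_1(x_1),\dots,w_n(x_n)]$ with $w_i:\mathbb R^{d_i}\to\mathbb R^{d_i}$. A velocity field $v$ assigns to $\rho\in\mathcal A$ the maps $v_i[\rho]:\mathbb R^{d_i}\to\mathbb R^{d_i}$, and $v[\rho](x)=[v_1[\rho](x_1),\dots,v_n[\rho](x_n)]$. $v$ is $\lambda$-monotone in a geodesically convex $\mathcal A$ if for any $\rho^{(0)},\rho^{(1)}\in\mathcal A$ and all $\gamma\in\Gamma^*(\rho^{(0)},\rho^{(1)})$, $-\int\langle x-y,v[\rho^{(0)}](x)-v[\rho^{(1)}](y)\rangle\mathrm d\gamma(x,y)\ge\lambda\int\|x-y\|^2\mathrm d\gamma(x,y)=\lambda\overline{\mathscr W}_2(\rho^{(0)},\rho^{(1)})^2$. $J_1[\rho]:\mathbb R^d\to\mathbb R^{d\times d}$ is block diagonal with blocks $(J_1[\rho](x))_{ii}=\nabla_{x_i}v_i[\rho](x_i)\in\mathbb R^{d_i\times d_i}$ (and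 $0$ for $i\ne j$); $J_2[\rho]:\mathbb R^d\times\mathbb R^d\to\mathbb R^{d\times d}$ has blocks $(J_2[\rho](x,\hat x))_{ij}=\nabla_{\hat x_j}\delta_{\rho_j}v_i[\rho](x_i,\hat x_j)\in\mathbb R^{d_i\times d_j}$, where $\delta_{\rho_j}v_i[\rho](x_i,\cdot)$ is the first variation with respect to $\rho_j$ of $\rho\mapsto v_i[\rho](x_i)$. $Y_i(\rho_i,\mathcal A_i)$ is the closure in $L^2(\rho_i)$ of the set of all $c_i(r_i-\mathrm{id})\in L^2(\rho_i)$ with $c_i>0$ a constant and $r_i:\mathbb R^{d_i}\to\mathbb R^{d_i}$ such that $(\mathrm{id}\times r_i)_\sharp\rho_i\in\Gamma_i^*(\rho_i,(r_i)_\sharp\rho_i)$ and $(r_i)_\sharp\rho_i\in\mathcal A_i$. Standing assumption: the velocity fields are regular enough that solutions $\rho(t)\in\overline{\mathcal P}_2$ of the flow exist. *)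

(* Defs.v *)
From HB Require Import structures.
From mathcomp Require Import all_boot all_order all_algebra.
From mathcomp Require Import all_classical all_reals all_analysis.

Set Implicit Arguments.
Unset Strict Implicit.
Unset Printing Implicit Defensive.
Import Order.TTheory GRing.Theory Num.Theory numFieldNormedType.Exports.
Local Open Scope classical_set_scope.
Local Open Scope ring_scope.

(* Borel sigma-algebra of R^k, for the (sup-norm, i.e. usual) topology that the
   library puts on matrices. *)
Definition mx_borel_display : measure_display.
Proof. exact. Qed.

Section borel_matrix.
Context (R : realType) (m n : nat).
Let mxopen : set (set 'M[R]_(m, n)) := open.
HB.instance Definition _ := @isMeasurable.Build mx_borel_display
  'M[R]_(m, n) <<s mxopen >> (@sigma_algebra0 _ setT mxopen)
  (@sigma_algebraC _ mxopen) (@sigma_algebra_bigcup _ setT mxopen).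
End borel_matrix.

Section euclidean.
Context {R : realType} {k : nat}.

(* The canonical norm of 'rV[R]_k is the sup norm; these are the Euclidean
   inner product and squared norm. *)
Definition dot (x y : 'rV[R]_k) : R := \sum_i x 0 i * y 0 i.
Definition sqnorm (x : 'rV[R]_k) : R := dot x x.

End euclidean.

Definition dprod_display : measure_display.
Proof. exact. Qed.

Definition dprod (n : nat) (T : 'I_n -> Type) : Type := forall i, T i.

Section dprod_measurable.
Context (n : nat) (disp : 'I_n -> measure_display)
  (T : forall i, measurableType (disp i)).

Let coor (i : 'I_n) (x : dprod T) : T i := x i.

(* The product sigma-algebra. *)
Definition dprod_cylinders : set (set (dprod T)) :=
  [set C | exists i, exists2 B : set (T i), measurable B & C = coor i @^-1` B].

HB.instance Definition _ := gen_eqMixin (dprod T).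
HB.instance Definition _ := gen_choiceMixin (dprod T).
HB.instance Definition _ := isPointed.Build (dprod T) (fun i => point).
HB.instance Definition _ := @isMeasurable.Build dprod_display (dprod T)
  <<s dprod_cylinders >> (@sigma_algebra0 _ setT dprod_cylinders)
  (@sigma_algebraC _ dprod_cylinders)
  (@sigma_algebra_bigcup _ setT dprod_cylinders).

Lemma measurable_coor i : measurable_fun setT (fun x : dprod T => x i).
Proof.
by move=> _ B mB; rewrite setTI; apply: sub_sigma_algebra; exists i, B.
Qed.

Lemma measurable_fun_dprodP d (S : measurableType d) (f : S -> dprod T) :
  (forall i, measurable_fun setT (fun s => f s i)) -> measurable_fun setT f.
Proof.
move=> mf; apply: (@measurability _ _ _ _ _ _ dprod_cylinders) => //.
move=> _ [_ [i [B mB ->]] <-]; exact: mf.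
Qed.

Section update.
Context (i : 'I_n).

Definition dprod_update (z : dprod T * T i) : dprod T := dfwith z.1 i z.2.

Lemma measurable_dprod_update : measurable_fun setT dprod_update.
Proof.
apply: measurable_fun_dprodP => j.
have [->|ij] := eqVneq j i.
  rewrite (_ : (fun _ => _) = snd); first exact: measurable_snd.
  by apply/funext => z; rewrite /dprod_update dfwithin.
rewrite (_ : (fun _ => _) = (fun x : dprod T => x j) \o (@fst (dprod T) (T i))).
  exact: (measurableT_comp (@measurable_coor j) measurable_fst).
by apply/funext => z; rewrite /dprod_update dfwithout// eq_sym.
Qed.

HB.instance Definition _ :=
  isMeasurableFun.Build _ _ _ _ dprod_update measurable_dprod_update.

End update.
End dprod_measurable.

Section product_of_probabilities.
Context {R : realType} {n : nat} {disp : 'I_n -> measure_display}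
  {T : forall i, measurableType (disp i)}.
Variable mu : forall i, probability (T i) R.

Let resample (i : 'I_n) (P : probability (dprod T) R) :
    probability (dprod T) R :=
  distribution (P \x mu i)%E (@dprod_update n disp T i).

(* The product measure \prod_i mu_i: starting from a Dirac mass, the coordinates
   are resampled independently, one after the other; see prodPE. *)
Definition prodP : probability (dprod T) R :=
  foldr resample (dirac (point : dprod T)) (enum 'I_n).

Let rect (A : forall i, set (T i)) : set (dprod T) :=
  [set x | forall i, A i (x i)].

Let measurable_rect A : (forall i, measurable (A i)) -> measurable (rect A).
Proof.
move=> mA; rewrite (_ : rect A = \bigcap_(i in [set: 'I_n]) ((fun x => x i) @^-1` A i)).
  by apply: fin_bigcap_measurable => // i _; rewrite -[X in measurable X]setTI;
    apply: measurable_coor.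
by apply/seteqP; split => [x Ax i _|x Ax i]; apply: Ax.
Qed.

Lemma prodPE (A : forall i, set (T i)) : (forall i, measurable (A i)) ->
  prodP [set x | forall i, A i (x i)] = (\prod_i mu i (A i))%E.
Proof.
move=> mA; rewrite -/(rect A) /prodP -[in RHS]big_enum/=.
have As j : j \notin enum 'I_n -> A j = setT by rewrite mem_enum.
elim: (enum 'I_n) (enum_uniq 'I_n) A mA As => [|i s IH] /= us A mA As.
  rewrite big_nil diracE mem_set// => i; by rewrite As.
case/andP: us => nis us.
rewrite big_cons /distribution /pushforward /=.
pose A' := dfwith A i setT.
have mA' j : measurable (A' j).
  by rewrite /A'; case: dfwithP => // *; exact: mA.
rewrite (_ : _ @^-1` _ = rect A' `*` A i); last first.
  apply/seteqP; split => -[x y] /=; rewrite /rect/= /dprod_update/= /A'.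
    move=> Axy; split=> [j|]; last by have := Axy i; rewrite dfwithin.
    have [->|ij] := eqVneq j i; first by rewrite dfwithin.
    by have := Axy j; rewrite !dfwithout 1?eq_sym.
  move=> [A'x Ay] j; have [->|ij] := eqVneq j i; first by rewrite dfwithin.
  by have := A'x j; rewrite !dfwithout 1?eq_sym.
transitivity (foldr resample \d_point s (rect A') * mu i (A i))%E.
  exact: product_measure1E (measurable_rect mA') (mA i).
rewrite IH// => [|j js].
  rewrite muleC; congr (_ * _)%E; apply: eq_big_seq => j js.
  by rewrite /A' dfwithout//; apply: contraNneq nis => ->.
have [->|ij] := eqVneq j i; first by rewrite /A' dfwithin.
by rewrite /A' dfwithout 1?eq_sym// As// in_cons negb_or ij.
Qed.

End product_of_probabilities.

Section single_species.
Context {R : realType}.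
Implicit Types k : nat.

(* nu is the push-forward of mu by f.  Probability measures of the library are
   functions on all subsets; they represent the same Borel measure when they
   agree on measurable sets, which is all that is asked for here and below. *)
Definition is_pushforward d1 d2 (S : measurableType d1) (T : measurableType d2)
    (f : S -> T) (mu : probability S R) (nu : probability T R) : Prop :=
  forall B : set T, measurable B -> nu B = mu (f @^-1` B).

Definition L2 k p (mu : probability 'rV[R]_k R) (f : 'rV[R]_k -> 'rV[R]_p) :=
  measurable_fun setT f /\ (\int[mu]_x (sqnorm (f x))%:E < +oo)%E.

Definition P2 k : set (probability 'rV[R]_k R) :=
  [set mu | (\int[mu]_x (sqnorm x)%:E < +oo)%E].

Definition coupling k (mu nu : probability 'rV[R]_k R) :
    set (probability ('rV[R]_k * 'rV[R]_k)%type R) :=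
  [set gam | is_pushforward fst gam mu /\ is_pushforward snd gam nu].

Definition cost k (gam : probability ('rV[R]_k * 'rV[R]_k)%type R) : \bar R :=
  (\int[gam]_z (sqnorm (z.1 - z.2))%:E)%E.

Definition optimal_coupling k (mu nu : probability 'rV[R]_k R) :
    set (probability ('rV[R]_k * 'rV[R]_k)%type R) :=
  [set gam | coupling mu nu gam /\
     forall gam', coupling mu nu gam' -> (cost gam <= cost gam')%E].

(* The infimum is finite on P2. *)
Definition W2 k (mu nu : probability 'rV[R]_k R) : R :=
  Num.sqrt (fine (ereal_inf (@cost k @` coupling mu nu))).

(* The L^2(rho)-closure of the fields c (r - id), r an optimal map from rho to
   an element of A. *)
Definition admissible k (rho : probability 'rV[R]_k R)
    (A : set (probability 'rV[R]_k R)) : set ('rV[R]_k -> 'rV[R]_k) :=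
  [set f | L2 rho f /\ forall e : R, 0 < e ->
     exists (c : R) (r : 'rV[R]_k -> 'rV[R]_k) (sigma : probability 'rV[R]_k R)
            (gam : probability ('rV[R]_k * 'rV[R]_k)%type R),
       [/\ 0 < c /\ measurable_fun setT r,
           L2 rho (fun x => c *: (r x - x)),
           is_pushforward r rho sigma /\ A sigma,
           is_pushforward (fun x => (x, r x)) rho gam /\
             optimal_coupling rho sigma gam &
           (\int[rho]_x (sqnorm (f x - c *: (r x - x)))%:E < (e ^+ 2)%:E)%E]].

Definition partial k (phi : 'rV[R]_k -> R) (a : 'I_k) (x : 'rV[R]_k) : R :=
  'D_(delta_mx 0 a) phi x.

Definition grad k (phi : 'rV[R]_k -> R) (x : 'rV[R]_k) : 'rV[R]_k :=
  \row_a partial phi a x.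

(* C^1_c(R^k); by mollification, testing against C^1_c or against C^oo_c
   functions amounts to the same. *)
Definition test_function k (phi : 'rV[R]_k -> R) : Prop :=
  [/\ forall x, differentiable phi x,
      forall a, continuous (partial phi a) &
      compact (closure [set x | phi x != 0])].

(* Lebesgue measure on R^k: the unique Borel measure with these values. *)
Definition is_lebesgue k (leb : {measure set 'rV[R]_k -> \bar R}) : Prop :=
  forall a b : 'rV[R]_k, (forall j, a 0 j <= b 0 j) ->
    leb [set x | forall j, a 0 j <= x 0 j <= b 0 j] =
    (\prod_j (b 0 j - a 0 j))%:E.

(* The weak gradient of f exists and is in L^oo_loc; as for the library's
   Jacobian matrices, the entry (a, b) is the derivative of f_b along e_a. *)
Definition grad_Loo_loc k (f : 'rV[R]_k -> 'rV[R]_k) : Prop :=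
  exists2 leb : {measure set 'rV[R]_k -> \bar R}, is_lebesgue leb &
  exists G : 'rV[R]_k -> 'M[R]_k,
    [/\ forall (K : set 'rV[R]_k) b, compact K ->
          leb.-integrable K (fun x => (f x 0 b)%:E),
        forall a b, measurable_fun setT (fun x => G x a b),
        forall K : set 'rV[R]_k, compact K ->
          exists C : R, {ae leb, forall x, K x -> forall a b, `|G x a b| <= C} &
        forall phi, test_function phi -> forall a b,
          (\int[leb]_x (f x 0 b * partial phi a x)%:E =
           - \int[leb]_x (phi x * G x a b)%:E)%E].

End single_species.

Section multi_species.
Context {R : realType} {n : nat} (d : 'I_n -> nat).

(* R^d, as the product of the R^{d_i}. *)
Definition Rd := dprod (fun i => 'rV[R]_(d i)).

Definition state := forall i, probability 'rV[R]_(d i) R.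

Definition velocity := state -> forall i, 'rV[R]_(d i) -> 'rV[R]_(d i).

Definition in_product (A : forall i, set (probability 'rV[R]_(d i) R)) :
    set state :=
  [set rho | forall i, A i (rho i)].

Definition delta0 : state := fun i => dirac (0 : 'rV[R]_(d i)).

Definition prod_state (rho : state) : probability Rd R := prodP rho.

Definition Wbar (rho mu : state) : R :=
  Num.sqrt (\sum_i (W2 (rho i) (mu i)) ^+ 2).

Definition second_moment (rho : state) : \bar R :=
  ((2^-1)%:E * \sum_i \int[rho i]_x (sqnorm x)%:E)%E.

Definition dissipation (v : velocity) (rho : state) : \bar R :=
  ((2^-1)%:E * \sum_i \int[rho i]_x (sqnorm (v rho i x))%:E)%E.

Definition geodesically_convex
    (A : forall i, set (probability 'rV[R]_(d i) R)) : Prop :=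
  forall rho0 rho1, in_product A rho0 -> in_product A rho1 ->
  forall gam, (forall i, optimal_coupling (rho0 i) (rho1 i) (gam i)) ->
  forall s : R, 0 <= s <= 1 ->
  forall rhos : state,
    (forall i, is_pushforward
       (fun z : 'rV[R]_(d i) * 'rV[R]_(d i) => (1 - s) *: z.1 + s *: z.2)
       (gam i) (rhos i)) ->
    in_product A rhos.

(* gam : forall i, probability (R^{d_i} x R^{d_i}) is integrated through its
   product measure, a point z of which is the list of the (x_i, y_i).  By
   optimality the first integral is Wbar rho0 rho1 ^+ 2. *)
Definition monotone_velocity (lambda : R) (v : velocity)
    (A : forall i, set (probability 'rV[R]_(d i) R)) : Prop :=
  forall rho0 rho1, in_product A rho0 -> in_product A rho1 ->
  forall gam, (forall i, optimal_coupling (rho0 i) (rho1 i) (gam i)) ->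
  (lambda%:E * \int[prodP gam]_z (\sum_i sqnorm ((z i).1 - (z i).2))%:E <=
   - \int[prodP gam]_z
       (\sum_i dot ((z i).1 - (z i).2)
                   (v rho0 i (z i).1 - v rho1 i (z i).2))%:E)%E.

(* g is a first variation at rho, with respect to rho_j, of F : state -> R^p:
   d/de F(rho + e chi) at e = 0+ is \int g dchi for the perturbations
   chi = sigma - rho_j of the j-th component that stay in A for small e. *)
Definition is_first_variation (A : forall i, set (probability 'rV[R]_(d i) R))
    p (F : state -> 'rV[R]_p) (rho : state) (j : 'I_n)
    (g : 'rV[R]_(d j) -> 'rV[R]_p) : Prop :=
  forall sigma : probability 'rV[R]_(d j) R, P2 sigma ->
  forall mu_ : R -> probability 'rV[R]_(d j) R,
    (\forall e \near 0^'+, A j (mu_ e) /\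
       forall B, measurable B ->
         mu_ e B = ((1 - e)%:E * rho j B + e%:E * sigma B)%E) ->
  forall a,
    [/\ (rho j).-integrable setT (fun x => (g x 0 a)%:E),
        sigma.-integrable setT (fun x => (g x 0 a)%:E) &
        e^-1 * (F (dfwith rho j (mu_ e)) 0 a - F rho 0 a) @[e --> 0^'+] -->
          (\int[sigma]_x g x 0 a - \int[rho j]_x g x 0 a)%R].

(* A choice of first variations: fv rho i j x is
   \delta_{rho_j} v_i[rho](x, .). *)
Definition first_variations :=
  state -> forall i j, 'rV[R]_(d i) -> 'rV[R]_(d j) -> 'rV[R]_(d i).

(* The Jacobian matrices of the library act on row vectors, hence the
   transpositions. *)
Definition J1 (v : velocity) (rho : state) (x : Rd) :
    'M[R]_(\sum_i d i) :=
  \mxdiag_i ('J (v rho i) (x i))^T.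

Definition J2 (fv : first_variations) (rho : state) (x x' : Rd) :
    'M[R]_(\sum_i d i) :=
  \mxblock_(i, j) ('J (fv rho i j (x i)) (x' j))^T.

Definition J_well_defined (A : forall i, set (probability 'rV[R]_(d i) R))
    (v : velocity) (fv : first_variations) (rho : state) : Prop :=
  {ae prod_state rho, forall x : Rd,
     [/\ forall i, differentiable (v rho i) (x i),
         forall i j, is_first_variation A (fun mu => v mu i (x i)) rho
                       (fv rho i j (x i)) &
         {ae prod_state rho, forall x' : Rd,
            forall i j, differentiable (fv rho i j (x i)) (x' j)}]}.

Definition quad (u : Rd) (J : 'M[R]_(\sum_i d i)) (w : Rd) : R :=
  ((\mxrow_i u i) *m J *m (\mxrow_i w i)^T) 0 0.

Definition vfield := forall i, 'rV[R]_(d i) -> 'rV[R]_(d i).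

Definition ev (w : vfield) (x : Rd) : Rd := fun i => w i (x i).

Definition shift_by (e : R) (w : vfield) (x : Rd) : Rd :=
  fun i => x i + e *: w i (x i).

(* \iint <w, J2[rho](x + e w, x' + e w) w> drhobar(x) drhobar(x')
   + \int <w, J1[rho](x + e w) w> drhobar *)
Definition hessian_form (v : velocity) (fv : first_variations)
    (rho : state) (e : R) (rhobar : state) (w : vfield) : \bar R :=
  (\int[prod_state rhobar \x prod_state rhobar]_z
      (quad (ev w z.1) (J2 fv rho (shift_by e w z.1) (shift_by e w z.2))
            (ev w z.2))%:E
   + \int[prod_state rhobar]_x
      (quad (ev w x) (J1 v rho (shift_by e w x)) (ev w x))%:E)%E.

Definition J_continuous (A : forall i, set (probability 'rV[R]_(d i) R))
    (v : velocity) (fv : first_variations) : Prop :=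
  forall (rho_ : R -> state) (rhobar : state),
    (forall e, 0 < e -> in_product A (rho_ e)) -> in_product A rhobar ->
    Wbar (rho_ e) rhobar @[e --> 0^'+] --> 0 ->
  forall w : vfield, (forall i, L2 (rhobar i) (w i)) ->
    hessian_form v fv (rho_ e) e rhobar w @[e --> 0^'+] -->
      hessian_form v fv rhobar 0 rhobar w.

(* Locally absolutely continuous curves [0, +oo[ -> (P2 x ... x P2, Wbar). *)
Definition locally_AC (rho : R -> state) : Prop :=
  exists m : R -> R,
    [/\ forall r, 0 <= m r,
        forall T, lebesgue_measure.-integrable `[0, T] (EFin \o m) &
        forall s t, 0 <= s -> s <= t ->
          ((Wbar (rho s) (rho t))%:E <=
             \int[lebesgue_measure]_(r in `[s, t]) (m r)%:E)%E].

(* rho is a locally absolutely continuous curve in (P2 x ... x P2, Wbar) that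
   solves d/dt rho_i + div (rho_i v_i[rho]) = 0 weakly. *)
Definition continuity_equation (v : velocity) (rho : R -> state) : Prop :=
  locally_AC rho /\
  forall i (phi : 'rV[R]_(d i) -> R), test_function phi ->
    let flux r := (\int[rho r i]_x (dot (grad phi x) (v (rho r) i x))%:E)%E in
    forall s t, 0 <= s -> s <= t ->
      lebesgue_measure.-integrable `[s, t] flux /\
      (\int[rho t i]_x (phi x)%:E = \int[rho s i]_x (phi x)%:E
         + \int[lebesgue_measure]_(r in `[s, t]) flux r)%E.

End multi_species.

(* Main.v *)
Require Import Defs.
From HB Require Import structures.
From mathcomp Require Import all_boot all_order all_algebra.
From mathcomp Require Import all_classical all_reals all_analysis.
From mathcomp Require Import measurable_realfun ring lra.
Import Order.TTheory GRing.Theory Num.Theory numFieldNormedType.Exports.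
Local Open Scope classical_set_scope.
Local Open Scope ring_scope.

(** Let S(t) be the sum over the species of the integrals of |x|^2 against
rho_i(t), that is, twice the second moment M.  The continuity equation tested
against |x|^2 says that S' = G, where G(t) is the sum of the integrals of
2 <x, v_i[rho(t)](x)> ([second_moment_derivative]).  All couplings of rho_i with
the Dirac mass at 0 are optimal, the one that sends x to (x, 0) among them, so
monotonicity between rho(t) and the vector of Dirac masses yields
G <= - lambda S + |v[delta_0](0)|^2 / lambda ([inward_drift]).  Hence S does not
increase while it is larger than |v[delta_0](0)|^2 / lambda^2, and it stays below
the maximum of this constant and S(0) ([le_max_barrier]).

The delicate point is that |x|^2 is not an admissible test function.  It is
approximated by compactly supported functions phi_N ([cutoff]) such that
|phi_N(x) - phi_N(y)| <= | |x|^2 - |y|^2 |.  The passage to the limit in the time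
integrals of the fluxes, int <grad phi_N, v_i> drho_i, needs a bound that is
integrable in time, and the L^2 norm of v_i[rho(t)] is not known to provide
one.  Instead, the increments of int phi_N drho_i are at most a constant, uniform in
N and locally in time, times the Wasserstein distance ([Rintegral_diff_le_W2]),
hence times the integral of the metric speed m of the curve.  Since this holds
on every time interval, the fluxes themselves are almost everywhere bounded by a
constant times m ([ae_le_of_itv]), and dominated convergence applies. *)

(** * The Euclidean structure *)

Section inner_product.
Context {R : realType} {k : nat}.
Implicit Types x y z : 'rV[R]_k.

Lemma dotC x y : dot x y = dot y x.
Proof. by apply: eq_bigr => i _; rewrite mulrC. Qed.

Lemma dotDl x y z : dot (x + y) z = dot x z + dot y z.
Proof. by rewrite -big_split; apply: eq_bigr => i _; rewrite mxE mulrDl. Qed.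

Lemma dotZl a x y : dot (a *: x) y = a * dot x y.
Proof. by rewrite mulr_sumr; apply: eq_bigr => i _; rewrite mxE mulrA. Qed.

Lemma dotNl x y : dot (- x) y = - dot x y.
Proof. by rewrite -scaleN1r dotZl mulN1r. Qed.

Lemma dotDr x y z : dot x (y + z) = dot x y + dot x z.
Proof. by rewrite dotC dotDl !(dotC x). Qed.

Lemma dotZr a x y : dot x (a *: y) = a * dot x y.
Proof. by rewrite dotC dotZl dotC. Qed.

Lemma dotNr x y : dot x (- y) = - dot x y.
Proof. by rewrite dotC dotNl dotC. Qed.

Lemma sqnorm_ge0 x : 0 <= sqnorm x.
Proof. by apply: sumr_ge0 => i _; rewrite -expr2 sqr_ge0. Qed.

Lemma sqnorm0 : sqnorm (0 : 'rV[R]_k) = 0.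
Proof. by apply: big1 => i _; rewrite mxE mul0r. Qed.

Lemma sqnorm_eq0 x : sqnorm x = 0 -> x = 0.
Proof.
move/eqP; rewrite psumr_eq0 => [/allP x0|i _]; last by rewrite -expr2 sqr_ge0.
apply/rowP => i; rewrite mxE; apply/eqP.
by have := x0 i (mem_index_enum i); rewrite /= -expr2 sqrf_eq0.
Qed.

Lemma sqnormD x y : sqnorm (x + y) = sqnorm x + 2 * dot x y + sqnorm y.
Proof. by rewrite /sqnorm dotDl !dotDr (dotC y x); ring. Qed.

Lemma sqnormB_dot x y : sqnorm x - sqnorm y = dot (x - y) (x + y).
Proof. by rewrite dotDl !dotDr !dotNl (dotC y x) /sqnorm; ring. Qed.

Lemma sqnormN x : sqnorm (- x) = sqnorm x.
Proof. by rewrite /sqnorm dotNl dotNr opprK. Qed.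

Lemma dot_young (a : R) x y : 0 < a ->
  2 * `|dot x y| <= a * sqnorm x + a^-1 * sqnorm y.
Proof.
move=> a0.
have H z : 0 <= a * sqnorm x + a^-1 * sqnorm z + 2 * dot x z.
  have -> : a * sqnorm x + a^-1 * sqnorm z + 2 * dot x z =
      a^-1 * sqnorm (a *: x + z).
    by rewrite sqnormD /sqnorm !dotZl !dotZr; field; rewrite gt_eqF.
  by rewrite mulr_ge0 ?sqnorm_ge0// invr_ge0 ltW.
have := H y; have := H (- y); rewrite sqnormN dotNr.
by case: (ler0P (dot x y)); lra.
Qed.

Lemma sqnormD_le x y : sqnorm (x + y) <= 2 * sqnorm x + 2 * sqnorm y.
Proof.
rewrite sqnormD; have := dot_young 1 x y ltr01; rewrite invr1.
by have := ler_norm (dot x y); lra.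
Qed.

End inner_product.

Section measurability.
Context {R : realType}.

Lemma measurable_coord {k} (i : 'I_k) :
  measurable_fun setT (fun x : 'rV[R]_k => x 0 i).
Proof.
apply: (measurability _ (RGenOpens.measurableE R)) => _ [B [a [b ->]] <-].
rewrite setTI; apply: sub_sigma_algebra.
move: (@interval_open R (BRight a) (BLeft b) erefl erefl).
by apply: open_comp => x _; exact: coord_continuous.
Qed.

Context {d : measure_display} {S : measurableType d} {k : nat}.
Implicit Types f g : S -> 'rV[R]_k.

Lemma measurable_dot f g :
  (forall i, measurable_fun setT (fun s => f s 0 i)) ->
  (forall i, measurable_fun setT (fun s => g s 0 i)) ->
  measurable_fun setT (fun s => dot (f s) (g s)).
Proof. by move=> mf mg; apply: measurable_sum => i; apply: measurable_funM. Qed.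

Lemma measurable_entry f i :
  measurable_fun setT f -> measurable_fun setT (fun s => f s 0 i).
Proof. by move=> mf; exact: (measurableT_comp (measurable_coord i) mf). Qed.

End measurability.

(** * Push-forwards and product measures *)

Section pushforward.
Context {R : realType} {d1 d2 : measure_display}.
Context {S : measurableType d1} {T : measurableType d2}.
Context (f : S -> T) (mu : probability S R) (nu : probability T R).
Hypotheses (mf : measurable_fun setT f) (fmu : is_pushforward f mu nu).
Implicit Type g : T -> \bar R.

Let nuE A : measurable A -> A `<=` setT -> nu A = pushforward mu f A.
Proof. by move=> mA _; exact: fmu. Qed.

Lemma ge0_integral_is_pushforward g :
  measurable_fun setT g -> (forall y, 0 <= g y)%E ->
  (\int[nu]_y g y = \int[mu]_x g (f x))%E.
Proof.
move=> mg g0.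
rewrite (@eq_measure_integral _ _ _ _ (pushforward mu f) nu g nuE).
by rewrite ge0_integral_pushforward.
Qed.

Lemma integrable_is_pushforward g : measurable_fun setT g ->
  mu.-integrable setT (g \o f) <-> nu.-integrable setT g.
Proof.
move=> mg.
have E : (\int[nu]_y `|g y| = \int[mu]_x `|(g \o f) x|)%E.
  apply: (ge0_integral_is_pushforward (fun y => `|g y|)%E) => //.
  exact: measurableT_comp.
split=> /integrableP[_ goo]; apply/integrableP; split=> //.
- by rewrite E.
- exact: measurableT_comp.
- by rewrite -E.
Qed.

Lemma integral_is_pushforward g : measurable_fun setT g ->
  nu.-integrable setT g -> (\int[nu]_y g y = \int[mu]_x g (f x))%E.
Proof.
move=> mg ig.
rewrite (@eq_measure_integral _ _ _ _ (pushforward mu f) nu g nuE).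
by rewrite integral_pushforward//; exact/integrable_is_pushforward.
Qed.

End pushforward.

Section product_marginal.
Context {R : realType} {n : nat} {disp : 'I_n -> measure_display}.
Context {T : forall i, measurableType (disp i)}.
Variable mu : forall i, probability (T i) R.

(** This is what reduces an integral against a product of couplings, as in the
monotonicity inequality, to one integral per species. *)
Lemma prodP_marginal (i : 'I_n) :
  is_pushforward (fun z : dprod T => z i) (prodP mu) (mu i).
Proof.
move=> B mB; pose C := dfwith (fun j => [set: T j]) i B.
have mC j : measurable (C j) by rewrite /C; case: dfwithP.
have -> : (fun z : dprod T => z i) @^-1` B = [set z | forall j, C j (z j)].
  apply/seteqP; split=> [z Bz j|z /(_ i)]; last by rewrite /C dfwithin.
  by rewrite /C; case: dfwithP.
rewrite prodPE// (bigD1 i)//= {1}/C dfwithin big1 ?mule1// => j ji.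
by rewrite /C dfwithout 1?eq_sym// probability_setT.
Qed.

End product_marginal.

Section second_moments.
Context {R : realType} {d : measure_display} {S : measurableType d} {k : nat}.
Context (mu : probability S R).
Implicit Types f g : S -> 'rV[R]_k.

Lemma integrable_EFin_ge0 (h : S -> R) : measurable_fun setT h ->
  (forall x, 0 <= h x) -> (\int[mu]_x (h x)%:E < +oo)%E ->
  mu.-integrable setT (EFin \o h).
Proof.
move=> mh h0 hoo; apply/integrableP; split; first exact/measurable_EFinP.
by under eq_integral do rewrite /= ger0_norm//.
Qed.

Lemma integrable_le (h1 h2 : S -> R) : measurable_fun setT h1 ->
  (forall x, `|h1 x| <= h2 x) -> mu.-integrable setT (EFin \o h2) ->
  mu.-integrable setT (EFin \o h1).
Proof.
move=> mh1 h12; apply: le_integrable => //; first exact/measurable_EFinP.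
move=> x _ /=; rewrite lee_fin (le_trans (h12 x))// ler_norm//.
Qed.

Lemma integrable_lin (a b : R) (f g : S -> R) :
  mu.-integrable setT (EFin \o f) -> mu.-integrable setT (EFin \o g) ->
  mu.-integrable setT (EFin \o (fun x => a * f x + b * g x)).
Proof.
move=> if_ ig; have := integrableD measurableT
  (integrableZl measurableT a if_) (integrableZl measurableT b ig).
exact: eq_integrable.
Qed.

Lemma Rintegral_lin (a b : R) (f g : S -> R) :
  mu.-integrable setT (EFin \o f) -> mu.-integrable setT (EFin \o g) ->
  \int[mu]_x (a * f x + b * g x) = a * \int[mu]_x f x + b * \int[mu]_x g x.
Proof.
move=> if_ ig; rewrite RintegralD//; last 2 first.
- by have := integrableZl measurableT a if_; apply: eq_integrable.
- by have := integrableZl measurableT b ig; exact: eq_integrable.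
by rewrite !RintegralZl.
Qed.

Lemma integrable_dot f g :
  (forall i, measurable_fun setT (fun s => f s 0 i)) ->
  (forall i, measurable_fun setT (fun s => g s 0 i)) ->
  mu.-integrable setT (fun s => (sqnorm (f s))%:E) ->
  mu.-integrable setT (fun s => (sqnorm (g s))%:E) ->
  mu.-integrable setT (fun s => (dot (f s) (g s))%:E).
Proof.
move=> mf mg if_ ig.
apply: (integrable_le _ (fun s => sqnorm (f s) + sqnorm (g s))).
- exact: measurable_dot.
- move=> x; have := dot_young 1 (f x) (g x) ltr01; rewrite invr1.
  by have := sqnorm_ge0 (f x); have := sqnorm_ge0 (g x); lra.
- exact: (integrableD _ if_ ig).
Qed.

End second_moments.

(** * Estimates by the Wasserstein distance *)

(** A family of weighted Young inequalities gives Cauchy-Schwarz by choosing the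
optimal weight; it turns the integral of a pointwise Young inequality into a
product of square roots of integrals. *)
Lemma le_sqrt_of_young {R : realType} (X a b : R) : 0 <= X -> 0 <= a -> 0 <= b ->
  (forall e, 0 < e -> 2 * X <= e * a + e^-1 * b) -> X <= Num.sqrt a * Num.sqrt b.
Proof.
move=> X0 a0 b0 H; rewrite -sqrtrM// -(ger0_norm X0) -sqrtr_sqr ler_wsqrtr//.
have [X0'|Xp] := leP X 0.
  by rewrite (_ : X = 0) ?expr0n ?mulr_ge0//; apply/le_anti/andP.
have [a_gt|a_le] := ltP 0 a.
  (* the weight that balances both terms *)
  have /H : 0 < X / a by rewrite divr_gt0.
  rewrite invf_div divfK ?gt_eqF// => {}H.
  have : X <= a / X * b by lra.
  by rewrite mulrAC ler_pdivlMr// expr2.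
(* without the first term, a large weight makes the second one too small *)
have a_eq : a = 0 by apply/le_anti/andP.
have /H : 0 < (b + 1) / X by rewrite divr_gt0// ltr_wpDl.
rewrite a_eq mulr0 add0r invf_div mulrAC ler_pdivlMr ?ltr_wpDl// => {}H.
by nra.
Qed.

Section wasserstein.
Context {R : realType} {k : nat}.
Implicit Types mu nu : probability 'rV[R]_k R.
Implicit Types gam : probability ('rV[R]_k * 'rV[R]_k)%type R.

Lemma measurable_sqnorm : measurable_fun setT (@sqnorm R k).
Proof. by apply: measurable_dot => i; exact: measurable_coord. Qed.

Lemma measurable_fst_entry i :
  measurable_fun setT (fun z : 'rV[R]_k * 'rV[R]_k => z.1 0 i).
Proof. exact: measurable_entry measurable_fst. Qed.

Lemma measurable_snd_entry i :
  measurable_fun setT (fun z : 'rV[R]_k * 'rV[R]_k => z.2 0 i).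
Proof. exact: measurable_entry measurable_snd. Qed.

Lemma measurable_cost :
  measurable_fun setT (fun z : 'rV[R]_k * 'rV[R]_k => sqnorm (z.1 - z.2)).
Proof.
apply: measurable_dot => i.
  under eq_fun do rewrite !mxE; apply: measurable_funB;
    [exact: measurable_fst_entry|exact: measurable_snd_entry].
under eq_fun do rewrite !mxE; apply: measurable_funB;
    [exact: measurable_fst_entry|exact: measurable_snd_entry].
Qed.

Lemma integrable_sqnorm mu : P2 mu -> mu.-integrable setT (fun x => (sqnorm x)%:E).
Proof.
by move=> mu2; apply: integrable_EFin_ge0 => //;
  [exact: measurable_sqnorm|exact: sqnorm_ge0].
Qed.

Section coupling.
Context (mu nu : probability 'rV[R]_k R) (mu2 : P2 mu) (nu2 : P2 nu).

(** The set of couplings is inhabited, and by [cost_EFin] their costs are finite;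
without this the infimum defining [W2] could be infinite and [fine] would send
it to 0. *)
Lemma coupling_product : coupling mu nu (mu \x nu)%E.
Proof.
split=> B mB.
- rewrite (_ : _ @^-1` _ = B `*` setT); last by apply/seteqP; split=> [] [x y] //= [].
  apply: esym; transitivity (mu B * nu setT)%E; first exact: product_measure1E.
  by rewrite probability_setT mule1.
- rewrite (_ : _ @^-1` _ = setT `*` B); last by apply/seteqP; split=> [] [x y] //= [].
  apply: esym; transitivity (mu setT * nu B)%E; first exact: product_measure1E.
  by rewrite probability_setT mul1e.
Qed.

Context (gam : probability ('rV[R]_k * 'rV[R]_k)%type R).
Hypothesis cgam : coupling mu nu gam.

Lemma integrable_coupling_fst :
  gam.-integrable setT (fun z => (sqnorm z.1)%:E).
Proof.
apply/(integrable_is_pushforward _ _ _ measurable_fst cgam.1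
  (fun x => (sqnorm x)%:E)).
  by apply/measurable_EFinP; exact: measurable_sqnorm.
exact: integrable_sqnorm.
Qed.

Lemma integrable_coupling_snd :
  gam.-integrable setT (fun z => (sqnorm z.2)%:E).
Proof.
apply/(integrable_is_pushforward _ _ _ measurable_snd cgam.2
  (fun x => (sqnorm x)%:E)).
  by apply/measurable_EFinP; exact: measurable_sqnorm.
exact: integrable_sqnorm.
Qed.

Lemma integrable_coupling_cost :
  gam.-integrable setT (fun z => (sqnorm (z.1 - z.2))%:E).
Proof.
apply: (integrable_le _ _ (fun z => 2 * sqnorm z.1 + 2 * sqnorm z.2)).
- exact: measurable_cost.
- move=> z; rewrite ger0_norm ?sqnorm_ge0//.
  by rewrite -[sqnorm z.2]sqnormN sqnormD_le.
- exact: integrable_lin integrable_coupling_fst integrable_coupling_snd.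
Qed.

Lemma cost_EFin : cost gam = (\int[gam]_z sqnorm (z.1 - z.2))%:E.
Proof.
by rewrite /cost /Rintegral fineK//; apply: integrable_fin_num => //;
  exact: integrable_coupling_cost.
Qed.

End coupling.

(** Lower bounds on all transport costs pass to [W2]: this avoids
the existence of optimal couplings. *)
Lemma le_W2_sqr mu nu (b : R) : P2 mu -> P2 nu ->
  (forall gam, coupling mu nu gam -> b <= \int[gam]_z sqnorm (z.1 - z.2)) ->
  b <= W2 mu nu ^+ 2.
Proof.
move=> mu2 nu2 H.
have inf_ge (c : R) : (forall gam, coupling mu nu gam -> c <= \int[gam]_z sqnorm (z.1 - z.2)) ->
  (c%:E <= ereal_inf (@cost R k @` coupling mu nu))%E.
  move=> cH; apply: le_ereal_inf_tmp => _ [gam cgam <-].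
  by rewrite (cost_EFin _ _ mu2 nu2 _ cgam) lee_fin cH.
have inf0 : (0 <= ereal_inf (@cost R k @` coupling mu nu))%E.
  by apply: inf_ge => gam _; apply: Rintegral_ge0 => z _; exact: sqnorm_ge0.
have inf_fin : ereal_inf (@cost R k @` coupling mu nu) \is a fin_num.
  rewrite ge0_fin_numE//; apply: (@le_lt_trans _ _ (cost (mu \x nu)%E)).
    by apply: ereal_inf_lbound; exists (mu \x nu)%E => //; exact: coupling_product.
  by rewrite (cost_EFin _ _ mu2 nu2 _ (coupling_product _ _)) ltry.
rewrite /W2 sqr_sqrtr ?fine_ge0// -lee_fin fineK//; exact: inf_ge.
Qed.

Lemma Rintegral_coupling_fst mu nu gam (f : 'rV[R]_k -> R) :
  coupling mu nu gam -> measurable_fun setT f -> mu.-integrable setT (EFin \o f) ->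
  gam.-integrable setT (fun z => (f z.1)%:E) /\
  \int[mu]_x f x = \int[gam]_z f z.1.
Proof.
move=> cgam mf fi; have mf' : measurable_fun setT (EFin \o f) by exact/measurable_EFinP.
split.
  exact/(integrable_is_pushforward _ _ _ measurable_fst cgam.1 _ mf').
by rewrite /Rintegral (integral_is_pushforward _ _ _ measurable_fst cgam.1 (EFin \o f)).
Qed.

Lemma Rintegral_coupling_snd mu nu gam (f : 'rV[R]_k -> R) :
  coupling mu nu gam -> measurable_fun setT f -> nu.-integrable setT (EFin \o f) ->
  gam.-integrable setT (fun z => (f z.2)%:E) /\
  \int[nu]_x f x = \int[gam]_z f z.2.
Proof.
move=> cgam mf fi; have mf' : measurable_fun setT (EFin \o f) by exact/measurable_EFinP.
split.
  exact/(integrable_is_pushforward _ _ _ measurable_snd cgam.2 _ mf').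
by rewrite /Rintegral (integral_is_pushforward _ _ _ measurable_snd cgam.2 (EFin \o f)).
Qed.

Lemma sqnorm_le_W2 mu nu : P2 mu -> P2 nu ->
  \int[nu]_x sqnorm x <= 2 * \int[mu]_x sqnorm x + 2 * W2 mu nu ^+ 2.
Proof.
move=> mu2 nu2.
suff : (\int[nu]_x sqnorm x - 2 * \int[mu]_x sqnorm x) / 2 <= W2 mu nu ^+ 2.
  by lra.
apply: le_W2_sqr => // gam cgam.
have [i1 ->] := Rintegral_coupling_fst _ _ _ _ cgam measurable_sqnorm (integrable_sqnorm _ mu2).
have [i2 ->] := Rintegral_coupling_snd _ _ _ _ cgam measurable_sqnorm (integrable_sqnorm _ nu2).
have i3 := integrable_coupling_cost _ _ mu2 nu2 _ cgam.
suff : \int[gam]_z sqnorm z.2 <= \int[gam]_z (2 * sqnorm z.1 + 2 * sqnorm (z.1 - z.2)).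
  by rewrite Rintegral_lin//; lra.
apply: le_Rintegral => //; first exact: integrable_lin.
move=> z _; have := sqnormD_le (- z.1) (z.1 - z.2).
  by rewrite addKr !sqnormN.
Qed.

(** Along any coupling, [f x - f y] is controlled by
[sqnorm x - sqnorm y = dot (x - y) (x + y)], hence by Cauchy-Schwarz by the cost
times the second moments.  The constant depends on [f] only through the
hypothesis, so it is the same for all the truncations of [sqnorm]. *)
Lemma Rintegral_diff_le_W2 mu nu (f : 'rV[R]_k -> R) :
  P2 mu -> P2 nu -> measurable_fun setT f ->
  (forall x y, `|f x - f y| <= `|sqnorm x - sqnorm y|) ->
  mu.-integrable setT (EFin \o f) -> nu.-integrable setT (EFin \o f) ->
  `|\int[nu]_x f x - \int[mu]_x f x| <=
  W2 mu nu * Num.sqrt (2 * \int[mu]_x sqnorm x + 2 * \int[nu]_x sqnorm x).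
Proof.
move=> mu2 nu2 mf lipf fmu fnu.
have sq_ge0 (m : probability 'rV[R]_k R) : 0 <= \int[m]_x sqnorm x.
  by apply: Rintegral_ge0 => x _; exact: sqnorm_ge0.
have -> : W2 mu nu = Num.sqrt (W2 mu nu ^+ 2).
  by rewrite sqrtr_sqr ger0_norm// sqrtr_ge0.
apply: le_sqrt_of_young => //; first exact: sqr_ge0.
  by rewrite addr_ge0// mulr_ge0.
move=> e e0; set K := 2 * _ + _; set F := `|_|.
suff : (2 * F - e^-1 * K) / e <= W2 mu nu ^+ 2.
  by rewrite ler_pdivrMr// lerBlDr [X in _ <= X + _]mulrC.
apply: le_W2_sqr => // gam cgam; rewrite ler_pdivrMr//.
have [i1 E1] := Rintegral_coupling_fst _ _ _ _ cgam measurable_sqnorm (integrable_sqnorm _ mu2).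
have [i2 E2] := Rintegral_coupling_snd _ _ _ _ cgam measurable_sqnorm (integrable_sqnorm _ nu2).
have [j1 F1] := Rintegral_coupling_fst _ _ _ _ cgam mf fmu.
have [j2 F2] := Rintegral_coupling_snd _ _ _ _ cgam mf fnu.
have i3 := integrable_coupling_cost _ _ mu2 nu2 _ cgam.
have j12 := integrableB measurableT j2 j1.
have nj12 := integrable_norm j12.
rewrite /F /K E1 E2 F1 F2 -RintegralB//.
have le1 : 2 * `|\int[gam]_z (f z.2 - f z.1)| <= \int[gam]_z (2 * `|f z.2 - f z.1|).
  rewrite RintegralZl//= ?ler_pM2l//.
  exact: le_normr_Rintegral.
have le2 : \int[gam]_z (2 * `|f z.2 - f z.1|) <=
  \int[gam]_z (e * sqnorm (z.1 - z.2) + e^-1 * (2 * sqnorm z.1 + 2 * sqnorm z.2)).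
  apply: le_Rintegral => //.
  - by have := integrableZl measurableT 2 nj12; exact: eq_integrable.
  - by apply: integrable_lin => //; exact: integrable_lin.
  - move=> z _; rewrite distrC; apply: le_trans (_ : 2 * `|sqnorm z.1 - sqnorm z.2| <= _).
      by rewrite ler_pM2l.
    rewrite sqnormB_dot (le_trans (dot_young _ _ _ e0))// lerD2l ler_pM2l ?invr_gt0//.
    exact: sqnormD_le.
apply: (@le_trans _ _ (\int[gam]_z (e * sqnorm (z.1 - z.2) +
  e^-1 * (2 * sqnorm z.1 + 2 * sqnorm z.2)) - e^-1 * (2 * \int[gam]_z sqnorm z.1 +
  2 * \int[gam]_z sqnorm z.2))).
  by rewrite lerB// (le_trans le1 le2).
rewrite Rintegral_lin//; last exact: integrable_lin.
by rewrite Rintegral_lin// addrK mulrC.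
Qed.
End wasserstein.

(** * Truncations of the squared norm *)

Section profile.
Context {R : realType}.
Implicit Types u w y : R.

(** The C^1 function u (1 - u)^2, cut to 0 for u >= 1, whose derivative at 0 is 1.
It is 1-Lipschitz on u >= 0, so that the truncations of [sqnorm] built from it
never vary more than [sqnorm] itself. *)
Definition profile u : R := u * Num.max 0 (1 - u) ^+ 2.
Definition dprofile u : R := Num.max 0 (1 - u) ^+ 2 - 2 * (u * Num.max 0 (1 - u)).

(** The positive part squared is C^1 but not C^2; a quadratic bound on the Taylor
remainder gives its derivative at every point at once, the junction included. *)
Lemma is_derive_quadratic_remainder (f : R -> R) (a l C : R) :
  (forall h, `|f (a + h) - f a - h * l| <= C * h ^+ 2) -> is_derive a 1 f l.
Proof.
move=> H; have Hc : h^-1 *: (f (h *: 1 + a) - f a) @[h --> 0^'] --> l.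
  apply/cvgrPdist_le => e e0.
  have C0 : 0 <= C.
    by have := H 1; rewrite expr1n mulr1; apply: le_trans; exact: normr_ge0.
  have C1 : 0 < C + 1 by rewrite ltr_wpDl.
  near=> h.
  have h0 : h != 0 by near: h; exact: nbhs_dnbhs_neq.
  rewrite /GRing.scale/= mulr1 (addrC h a).
  have -> : l - h^-1 * (f (a + h) - f a) = - (h^-1 * (f (a + h) - f a - h * l)).
    by rewrite [in RHS]mulrBr mulrA mulVf// mul1r opprB.
  rewrite normrN normrM normfV ler_pdivrMl ?normr_gt0//.
  rewrite (le_trans (H h))// -(real_normK (num_real h)) expr2 mulrCA ler_wpM2l//.
  have hC : `|h| <= e / (C + 1) by near: h; apply: dnbhs0_le; rewrite divr_gt0.
  rewrite (le_trans (ler_wpM2l C0 hC))// mulrCA ler_piMr ?(ltW e0)//.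
  by rewrite ler_pdivrMr// mul1r lerDl.
split; first by apply/cvg_ex; exists l.
by apply/cvg_lim => //; exact: Rhausdorff.
Unshelve. all: by end_near. Qed.

Lemma profile_lip u w : 0 <= u -> 0 <= w -> `|profile u - profile w| <= `|u - w|.
Proof.
wlog uw : u w / u <= w.
  move=> H u0 w0; have [uw|/ltW wu] := leP u w; first exact: H.
  by rewrite distrC [leRHS]distrC; exact: H.
move=> u0 w0; rewrite /profile.
have [w1|w1] := leP w 1.
  have u1 : u <= 1 by exact: le_trans w1.
  rewrite !max_r ?subr_ge0//.
  rewrite (_ : _ - _ = (u - w) * (1 - 2 * (u + w) + (u + w) ^+ 2 - u * w)); last by ring.
  by rewrite normrM ler_piMr// ler_norml; apply/andP; split; nra.
rewrite [Num.max 0 (1 - w)]max_l ?subr_le0 ?(ltW w1)// expr0n mulr0 subr0.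
have -> : `|u - w| = w - u by rewrite ler0_norm ?subr_le0// opprB.
have [u1|u1] := leP u 1.
  have h' : 0 <= 1 - u by rewrite subr_ge0.
  rewrite max_r// ger0_norm ?mulr_ge0 ?sqr_ge0//.
  have h : u * (1 - u) <= 1 by nra.
  have := ler_wpM2r h' h; rewrite mul1r -mulrA -expr2; lra.
by rewrite max_l ?subr_le0 ?(ltW u1)// expr0n mulr0 normr0; lra.
Qed.

Lemma dprofile_le1 u : 0 <= u -> `|dprofile u| <= 1.
Proof.
move=> u0; rewrite /dprofile; have [u1|u1] := leP u 1.
  by rewrite max_r ?subr_ge0// ler_norml; apply/andP; split; nra.
by rewrite max_l ?subr_le0 ?(ltW u1)// expr0n !mulr0 subrr normr0.
Qed.

Lemma continuous_posp : continuous (fun u : R => Num.max 0 (1 - u)).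
Proof.
move=> u; apply: (continuous_max (f := cst 0 : R -> R^o) (g := (fun v => 1 - v) : R -> R^o)).
  exact: cvg_cst.
by apply: cvgB; [exact: cvg_cst|exact: cvg_id].
Qed.

Lemma continuous_sqposp : continuous (fun u : R => Num.max 0 (1 - u) ^+ 2).
Proof.
move=> u; apply: (@continuous_comp _ _ _ (fun u : R => Num.max 0 (1 - u)) (fun y => y ^+ 2)).
  exact: continuous_posp.
exact: exprn_continuous.
Qed.

Lemma continuous_dprofile : continuous dprofile.
Proof.
move=> u; apply: cvgB; first exact: continuous_sqposp.
by apply: cvgM; [exact: cvg_cst|apply: cvgM; [exact: cvg_id|exact: continuous_posp]].
Qed.

Lemma is_derive_profile u : is_derive u 1 profile (dprofile u).
Proof.
pose q (y : R) := Num.max 0 (1 - y) ^+ 2.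
have dq : is_derive u 1 q (- 2 * Num.max 0 (1 - u)).
  apply: (is_derive_quadratic_remainder _ _ _ 1) => h; rewrite mul1r /q.
  have [a|a] := leP 0 (1 - u); have [b|b] := leP 0 (1 - (u + h));
    rewrite ler_norml; apply/andP; split; nra.
rewrite (_ : profile = id * q)//.
apply: (is_derive_eq (is_deriveM (is_derive_id u 1) dq)).
by rewrite /dprofile /GRing.scale/= /q; ring.
Qed.

End profile.

Section cutoff.
Context {R : realType} {k : nat} (N : R) (N0 : 0 < N).
Implicit Type x : 'rV[R]_k.

(** A compactly supported truncation of [sqnorm], equal to it to first order
where [sqnorm x] is small compared to [N]. *)
Definition cutoff x : R := N * profile (sqnorm x / N).

Lemma differentiable_sqnorm x : differentiable (@sqnorm R k) x.
Proof.
rewrite (_ : @sqnorm R k = \sum_(i < k) (fun y : 'rV[R]_k => y 0 i * y 0 i)).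
  by apply: differentiable_sum => i; apply: differentiableM; exact: differentiable_coord.
by apply/funext => y; rewrite fct_sumE.
Qed.

Lemma partial_sqnorm a x : partial (@sqnorm R k) a x = 2 * x 0 a.
Proof.
pose e : 'rV[R]_k := delta_mx 0 a.
have xe (y : 'rV[R]_k) : dot y e = y 0 a.
  rewrite /dot (bigD1 a)//= mxE !eqxx mulr1 big1 ?addr0// => i ia.
  by rewrite mxE (negbTE ia) andbF mulr0.
apply/cvg_lim; first exact: Rhausdorff.
have E : {near 0^', (fun h : R => 2 * x 0 a + h) =1
  (fun h : R => h^-1 *: (sqnorm (h *: e + x) - sqnorm x))}.
  near=> h.
  have h0 : h != 0 by near: h; exact: nbhs_dnbhs_neq.
  rewrite sqnormD /sqnorm !dotZl !dotZr (dotC _ x) !xe /e mxE !eqxx/=.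
  by rewrite /GRing.scale/= addrK; field.
apply: (cvg_trans (near_eq_cvg E)).
have : 2 * x 0 a + h @[h --> 0^'] --> 2 * x 0 a + (0 : R).
  by apply: cvgD; [exact: cvg_cst|exact/cvg_within].
by rewrite addr0.
Unshelve. all: by end_near. Qed.

Let cutoffE : cutoff = (fun u : R => N * profile (u / N)) \o @sqnorm R k.
Proof. by []. Qed.

Let is_derive_outer (u : R) : is_derive u 1 (fun u : R => N * profile (u / N)) (dprofile (u / N)).
Proof.
have d1 : is_derive u 1 (fun u : R => u / N) (N^-1).
  rewrite (_ : (fun _ => _) = id * cst N^-1)//.
  apply: (is_derive_eq (is_deriveM (is_derive_id u 1) (is_derive_cst N^-1 u 1))).
  by rewrite scaler0 add0r /GRing.scale/= mulr1.
have d2 := is_derive1_comp (g := fun u => u / N) (is_derive_profile (u / N)) d1.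
rewrite (_ : (fun _ => _) = N \*: (profile \o (fun u => u / N)))//.
apply: (is_derive_eq (is_deriveZ N d2)).
by rewrite /GRing.scale/= mulrC divfK// gt_eqF.
Qed.

Lemma differentiable_cutoff x : differentiable cutoff x.
Proof.
rewrite cutoffE; apply: differentiable_comp; first exact: differentiable_sqnorm.
by apply/derivable1_diffP; case: (is_derive_outer (sqnorm x)).
Qed.

Lemma partial_cutoff a x :
  partial cutoff a x = dprofile (sqnorm x / N) * (2 * x 0 a).
Proof.
have dN : differentiable (fun u : R => N * profile (u / N)) (sqnorm x).
  by apply/derivable1_diffP; case: (is_derive_outer (sqnorm x)).
rewrite /partial (deriveE _ (differentiable_cutoff x)) cutoffE.
rewrite (diff_comp (differentiable_sqnorm x) dN)/=.
rewrite -(deriveE _ (differentiable_sqnorm x)).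
rewrite -/(partial _ a x) partial_sqnorm diff1E// derive1E.
by have [_ ->] := is_derive_outer (sqnorm x); rewrite /GRing.scale/= mulrC.
Qed.

Lemma grad_cutoff x : grad cutoff x = (2 * dprofile (sqnorm x / N)) *: x.
Proof. by apply/rowP => a; rewrite !mxE partial_cutoff; ring. Qed.

Lemma continuous_sqnorm : continuous (@sqnorm R k).
Proof. by move=> x; apply: differentiable_continuous; exact: differentiable_sqnorm. Qed.

Lemma test_function_cutoff : test_function cutoff.
Proof.
split; first exact: differentiable_cutoff.
  move=> a; rewrite (_ : partial cutoff a =
      (dprofile \o (@sqnorm R k * cst N^-1)) * (cst 2 * (fun x => x 0 a))); last first.
    by apply/funext => y; exact: partial_cutoff.
  move=> x; apply: continuousM.
    apply: continuous_comp; last exact: continuous_dprofile.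
    by apply: continuousM; [exact: continuous_sqnorm|exact: cst_continuous].
  by apply: continuousM; [exact: cst_continuous|exact: coord_continuous].
pose B := [set x : 'rV[R]_k | sqnorm x <= N].
have cB : closed B.
  by apply: (@closed_comp _ _ (@sqnorm R k) [set u | u <= N]);
    [move=> x _; exact: continuous_sqnorm|exact: closed_le].
have subB : closure [set x | cutoff x != 0] `<=` B.
  rewrite [X in _ `<=` X](closure_id B).1//; apply: closureS => x /=.
  apply: contraNT; rewrite -ltNge => Nx; rewrite /cutoff /profile max_l ?expr0n ?mulr0//.
  by rewrite subr_le0 ler_pdivlMr// mul1r ltW.
(* |x_i|^2 <= N, and N + 1 bounds its own square root *)
have cube : compact [set x : 'rV[R]_k | forall i, `[- (N + 1), N + 1]%classic (x ord0 i)].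
  by apply: (rV_compact (A := fun=> `[- (N + 1), N + 1]%classic)) => i; exact: segment_compact.
apply: subclosed_compact cube _; first exact: closed_closure.
move=> x /subB Bx i /=; rewrite in_itv/=.
have xi : x 0 i ^+ 2 <= N.
  apply: le_trans Bx; rewrite /sqnorm /dot (bigD1 i)//= -expr2 lerDl.
  by apply: sumr_ge0 => j _; rewrite -expr2 sqr_ge0.
by apply/andP; split; nra.
Qed.

End cutoff.

Section cutoff_estimates.
Context {R : realType} {k : nat} (N : R) (N0 : 0 < N).
Implicit Types x y : 'rV[R]_k.

Lemma cutoff_lip x y : `|cutoff N x - cutoff N y| <= `|sqnorm x - sqnorm y|.
Proof.
have le0 z : 0 <= sqnorm z / N :> R by rewrite divr_ge0 ?sqnorm_ge0// ltW.
rewrite /cutoff -mulrBr normrM gtr0_norm//.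
apply: (le_trans (ler_wpM2l (ltW N0) (profile_lip _ _ (le0 _ x) (le0 _ y)))).
rewrite -mulrBl normrM (gtr0_norm (_ : 0 < N^-1)) ?invr_gt0//.
by rewrite mulrC divfK// gt_eqF.
Qed.

Lemma cutoff_le x : `|cutoff N x| <= sqnorm x.
Proof.
have := cutoff_lip x 0.
have -> : cutoff N (0 : 'rV[R]_k) = 0 by rewrite /cutoff /profile sqnorm0 !mul0r mulr0.
by rewrite sqnorm0 !subr0 (ger0_norm (sqnorm_ge0 x)).
Qed.

Lemma measurable_cutoff : measurable_fun setT (@cutoff R k N).
Proof.
apply: measurable_funM => //.
apply: measurable_funM; first by apply: measurable_funM => //; exact: measurable_sqnorm.
apply: (@measurableT_comp _ _ _ _ _ _ (fun u : R => Num.max 0 (1 - u) ^+ 2)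
  _ (fun x : 'rV[R]_k => sqnorm x / N)).
  by apply: continuous_measurable_fun; exact: continuous_sqposp.
by apply: measurable_funM => //; exact: measurable_sqnorm.
Qed.

Lemma dot_grad_cutoff x y :
  dot (grad (cutoff N) x) y = 2 * dprofile (sqnorm x / N) * dot x y.
Proof. by rewrite grad_cutoff// dotZl. Qed.

Lemma dot_grad_cutoff_le x y :
  `|dot (grad (cutoff N) x) y| <= sqnorm x + sqnorm y.
Proof.
rewrite dot_grad_cutoff !normrM ger0_norm//.
have h : `|dprofile (sqnorm x / N)| <= 1.
  by apply: dprofile_le1; rewrite divr_ge0 ?sqnorm_ge0// ltW.
have := dot_young 1 x y ltr01; rewrite invr1 !mul1r; apply: le_trans.
by rewrite -mulrA ler_pM2l// ler_piMl.
Qed.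

End cutoff_estimates.

Section cutoff_limit.
Context {R : realType} {k : nat}.
Implicit Types x y : 'rV[R]_k.

Let ratio_cvg (u : R) : u / n.+1%:R @[n --> \oo] --> (0 : R).
Proof.
rewrite -[X in _ --> X](mulr0 u); apply: cvgM; first exact: cvg_cst.
exact: cvg_harmonic.
Qed.

Lemma cutoff_cvg x : cutoff n.+1%:R x @[n --> \oo] --> sqnorm x.
Proof.
have -> : (fun n : nat => cutoff n.+1%:R x) =
    (fun n : nat => sqnorm x * Num.max 0 (1 - sqnorm x / n.+1%:R) ^+ 2).
  apply/funext => n; rewrite /cutoff /profile !mulrA (mulrC n.+1%:R) mulfK//.
rewrite -[X in _ --> X]mulr1; apply: cvgM; first exact: cvg_cst.
have := cvg_comp _ _ (ratio_cvg (sqnorm x)) (continuous_sqposp 0).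
by rewrite subr0 max_r// expr1n.
Qed.

Lemma dot_grad_cutoff_cvg x y :
  dot (grad (cutoff n.+1%:R) x) y @[n --> \oo] --> 2 * dot x y.
Proof.
under eq_fun do rewrite dot_grad_cutoff//.
apply: cvgM; last exact: cvg_cst.
rewrite -[X in _ --> X]mulr1; apply: cvgM; first exact: cvg_cst.
have := cvg_comp _ _ (ratio_cvg (sqnorm x)) (continuous_dprofile 0).
by rewrite /dprofile mul0r mulr0 !subr0 max_r// expr1n.
Qed.

End cutoff_limit.

(** * Functions with ordered integrals over all intervals *)

Section interval_integrals.
Context {R : realType}.
Implicit Types f g h : R -> R.
Let leb := @lebesgue_measure R.

Lemma Rintegral_itv_chasles (a b T : R) h : a <= b -> b <= T ->
  leb.-integrable `[a, T] (EFin \o h) ->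
  \int[leb]_(r in `[a, T]) h r =
  \int[leb]_(r in `[a, b]) h r + \int[leb]_(r in `[b, T]) h r.
Proof.
move=> ab bT ih.
have := Rintegral_itvB (x := b) ih; rewrite !bnd_simp => /(_ ab bT).
rewrite Rintegral_itv_obnd_cbnd => [<-|]; first by rewrite addrC subrK.
apply: integrableS ih => // r /=; rewrite !in_itv/= => /andP[br ->].
by rewrite (le_trans ab (ltW br)).
Qed.

(** The primitive of [h] is nondecreasing on [0, T], and its derivative is [h]
at every Lebesgue point. *)
Lemma ae_ge0_of_itv (T : R) h : leb.-integrable `[0, T] (EFin \o h) ->
  (forall s t : R, 0 <= s -> s <= t -> t <= T -> 0 <= \int[leb]_(r in `[s, t]) h r) ->
  {ae leb, forall r, r \in `[0, T] -> 0 <= h r}.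
Proof.
move=> ih H; pose h1 := h \_ `[0, T].
have lh1 : locally_integrable setT h1 by apply: integrable_locally ih.
have h1E (s t : R) : 0 <= s -> t <= T ->
    \int[leb]_(r in `[s, t]) h1 r = \int[leb]_(r in `[s, t]) h r.
  move=> s0 tT; apply: eq_Rintegral => r; rewrite inE/= in_itv/= => /andP[sr rt].
  by rewrite /h1 patchE mem_set//= in_itv/= (le_trans s0 sr) (le_trans rt tT).
have ih1 : leb.-integrable `[0, T] (EFin \o h1).
  apply: eq_integrable ih => // r; rewrite inE => r0T /=.
  by rewrite /h1 patchE mem_set.
have h1_ge0 (x : R) : 0 < x -> x < T -> lebesgue_pt h1 x -> 0 <= h1 x.
  move=> x0 xT px.
  have [|dF <-] := @FTC1_lebesgue_pt _ h1 (BLeft 0) x T xT ih1 _ px.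
    by rewrite /= lte_fin.
  rewrite derive1E; apply: limr_ge; first exact: dF.
  near=> e.
  have e0 : e != 0 by near: e; exact: nbhs_dnbhs_neq.
  have eT : `|e| <= T - x by near: e; apply: dnbhs0_le; rewrite subr_gt0.
  have ex : `|e| <= x by near: e; exact: dnbhs0_le.
  have mono (a b : R) : 0 <= a -> a <= b -> b <= T ->
      \int[leb]_(r in `[0, a]) h1 r <= \int[leb]_(r in `[0, b]) h1 r.
    move=> a0 ab bT; rewrite (Rintegral_itv_chasles 0 a b)//.
      by rewrite lerDl h1E// H.
    by apply: integrableS ih1 => // r /=; rewrite !in_itv/= => /andP[->/le_trans->].
  move: eT ex; rewrite !ler_norml => /andP[e1 e2] /andP[e3 e4].
  rewrite /GRing.scale/= mulr1.
  have [ep|en] := ltP 0 e.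
    by rewrite mulr_ge0 ?invr_ge0 ?(ltW ep)// subr_ge0 mono//; lra.
  by rewrite mulr_le0 ?invr_le0// subr_le0 mono//; lra.
have := lebesgue_differentiation lh1.
have n0 : {ae leb, forall r, r != 0}.
  exists [set 0]; split => [||r]; [exact: measurable_set1|exact: lebesgue_measure_set1|] => /=.
  by move/negP; rewrite negbK => /eqP.
have nT : {ae leb, forall r, r != T}.
  exists [set T]; split => [||r]; [exact: measurable_set1|exact: lebesgue_measure_set1|] => /=.
  by move/negP; rewrite negbK => /eqP.
move: n0 nT; apply: filterS3; first exact: (ae_filter_ringOfSetsType leb).
move=> r r0 rT pr r0T; have := r0T; rewrite /= in_itv/= => /andP[r0' rT'].
have -> : h r = h1 r by rewrite /h1 patchE mem_set.
by apply: h1_ge0 => //; rewrite lt_neqAle ?r0' ?rT' ?andbT// eq_sym.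
Unshelve. all: by end_near. Qed.

Lemma ae_le_of_itv (T : R) f g : leb.-integrable `[0, T] (EFin \o f) ->
  leb.-integrable `[0, T] (EFin \o g) ->
  (forall s t : R, 0 <= s -> s <= t -> t <= T ->
    \int[leb]_(r in `[s, t]) f r <= \int[leb]_(r in `[s, t]) g r) ->
  {ae leb, forall r, r \in `[0, T] -> f r <= g r}.
Proof.
move=> if_ ig H; have igf : leb.-integrable `[0, T] (EFin \o (g \- f)).
  by have := integrableB _ ig if_; apply => //.
have := ae_ge0_of_itv T (g \- f) igf.
have sub (s t : R) : 0 <= s -> t <= T -> `[s, t] `<=` `[0, T].
  move=> s0 tT r /=; rewrite !in_itv/= => /andP[sr rt].
  by rewrite (le_trans s0 sr) (le_trans rt tT).
have HH (s t : R) : 0 <= s -> s <= t -> t <= T -> 0 <= \int[leb]_(r in `[s, t]) (g \- f) r.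
  move=> s0 st tT; rewrite RintegralB//= ?subr_ge0 ?H//.
    by apply: integrableS ig => //; exact: sub.
  by apply: integrableS if_ => //; exact: sub.
move=> /(_ HH); apply: filterS; first exact: (ae_filter_ringOfSetsType leb).
by move=> r hr r0T; rewrite -subr_ge0 hr.
Qed.

End interval_integrals.

(** * Evolution of the second moment of one species *)

Lemma Rintegral_dominated_cvg {R : realType} d (X : measurableType d)
  (mu : {measure set X -> \bar R}) (D : set X) (f_ : (X -> R)^nat) (f g : X -> R) :
  measurable D -> (forall n, measurable_fun D (f_ n)) ->
  (forall x, D x -> f_ n x @[n --> \oo] --> f x) ->
  mu.-integrable D (EFin \o g) ->
  (forall n, {ae mu, forall x, D x -> `|f_ n x| <= g x}) ->
  mu.-integrable D (EFin \o f) /\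
  \int[mu]_(x in D) f_ n x @[n --> \oo] --> \int[mu]_(x in D) f x.
Proof.
move=> mD mf_ f_f ig f_g.
have mf : measurable_fun D f by exact: measurable_fun_cvg mf_ f_f.
have [|||||if_ _ lim] := @dominated_convergence _ _ _ mu D mD
    (fun n => EFin \o f_ n) (EFin \o f) (EFin \o g).
- by move=> n; exact/measurable_EFinP.
- exact/measurable_EFinP.
- by apply: aeW => x Dx; apply: cvg_EFin; [exact: nearW|exact: f_f].
- exact: ig.
- have := @ae_foralln _ _ _ mu _ f_g; apply: filterS.
  by move=> x H n Dx /=; rewrite lee_fin H.
split=> //; apply: fine_cvg; rewrite fineK//.
exact: integrable_fin_num.
Qed.

(** In this section [mu] is the curve of one species, [u] its velocity and [m] a
bound on its metric speed. *)
Section one_species.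
Context {R : realType} {k : nat}.
Variables (mu : R -> probability 'rV[R]_k R) (u : R -> 'rV[R]_k -> 'rV[R]_k).
Variable m : R -> R.
Let leb := @lebesgue_measure R.
Hypothesis mu2 : forall t, 0 <= t -> P2 (mu t).
Hypothesis uL2 : forall t, 0 <= t -> L2 (mu t) (u t).
Hypothesis m_ge0 : forall t, 0 <= m t.
Hypothesis im : forall t, leb.-integrable `[0, t] (EFin \o m).
Hypothesis W2_le : forall s t, 0 <= s -> s <= t ->
  W2 (mu s) (mu t) <= \int[leb]_(r in `[s, t]) m r.
Hypothesis transport : forall phi : 'rV[R]_k -> R, test_function phi ->
  let flux r := (\int[mu r]_x (dot (grad phi x) (u r x))%:E)%E in
  forall s t, 0 <= s -> s <= t ->
    leb.-integrable `[s, t] flux /\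
    (\int[mu t]_x (phi x)%:E = \int[mu s]_x (phi x)%:E
       + \int[leb]_(r in `[s, t]) flux r)%E.

Let S t := \int[mu t]_x sqnorm x.
Let S_ge0 t : 0 <= S t.
Proof. by apply: Rintegral_ge0 => x _; exact: sqnorm_ge0. Qed.

Let phi (n : nat) := @cutoff R k n.+1%:R.
Let Phi n t := \int[mu t]_x phi n x.
Let flux n r := \int[mu r]_x dot (grad (phi n) x) (u r x).
Let G r := \int[mu r]_x (2 * dot x (u r x)).

Let sub_itv (s t T : R) : 0 <= s -> t <= T -> `[s, t] `<=` `[0, T].
Proof.
move=> s0 tT r /=; rewrite !in_itv/= => /andP[sr rt].
by rewrite (le_trans s0 sr) (le_trans rt tT).
Qed.

Let im_itv (s t : R) : 0 <= s -> leb.-integrable `[s, t] (EFin \o m).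
Proof. by move=> s0; apply: integrableS (im t) => //; exact: sub_itv. Qed.

Let integrable_sqnorm_u t : 0 <= t ->
  (mu t).-integrable setT (fun x => (sqnorm (u t x))%:E).
Proof.
move=> t0; have [mu_ u2] := uL2 t t0.
apply: integrable_EFin_ge0 => // [|x]; last exact: sqnorm_ge0.
by apply: measurable_dot => i; exact: measurable_entry.
Qed.

Let measurable_dot_u t : 0 <= t -> measurable_fun setT (fun x => dot x (u t x)).
Proof.
move=> t0; have [mu_ u2] := uL2 t t0.
by apply: measurable_dot => i; [exact: measurable_coord|exact: measurable_entry].
Qed.

Let measurable_flux n t : 0 <= t ->
  measurable_fun setT (fun x => dot (grad (phi n) x) (u t x)).
Proof.
move=> t0; under eq_fun do rewrite dot_grad_cutoff//.
apply: measurable_funM; last exact: measurable_dot_u.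
apply: measurable_funM => //.
apply: (@measurableT_comp _ _ _ _ _ _ (@dprofile R) _ (fun x : 'rV[R]_k => sqnorm x / n.+1%:R)).
  by apply: continuous_measurable_fun; exact: continuous_dprofile.
by apply: measurable_funM => //; exact: measurable_sqnorm.
Qed.

Let integrable_bound t : 0 <= t ->
  (mu t).-integrable setT (EFin \o (fun x => sqnorm x + sqnorm (u t x))).
Proof.
move=> t0; have := integrableD measurableT
  (integrable_sqnorm _ (mu2 t t0)) (integrable_sqnorm_u t t0).
exact: eq_integrable.
Qed.

Let integrable_flux n t : 0 <= t ->
  (mu t).-integrable setT (EFin \o (fun x => dot (grad (phi n) x) (u t x))).
Proof.
move=> t0; apply: integrable_le (integrable_bound t t0).
  exact: measurable_flux.
by move=> x; apply: dot_grad_cutoff_le.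
Qed.

Let integrable_phi n t : 0 <= t -> (mu t).-integrable setT (EFin \o phi n).
Proof.
move=> t0; apply: integrable_le (integrable_sqnorm _ (mu2 t t0)).
  exact: measurable_cutoff.
by move=> x; apply: cutoff_le.
Qed.

Let Phi_cvg t : 0 <= t -> Phi n t @[n --> \oo] --> S t.
Proof.
move=> t0; have [] // := @Rintegral_dominated_cvg _ _ _ (mu t) setT
  phi (@sqnorm R k) (@sqnorm R k).
- by move=> n; exact: measurable_cutoff.
- by move=> x _; exact: cutoff_cvg.
- exact: integrable_sqnorm (mu2 t t0).
- by move=> n; apply: aeW => x _; exact: cutoff_le.
Qed.

Let flux_cvg t : 0 <= t -> flux n t @[n --> \oo] --> G t.
Proof.
move=> t0; have [] // := @Rintegral_dominated_cvg _ _ _ (mu t) setT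
  (fun n x => dot (grad (phi n) x) (u t x)) (fun x => 2 * dot x (u t x))
  (fun x => sqnorm x + sqnorm (u t x)).
- by move=> n; exact: measurable_flux.
- by move=> x _; exact: dot_grad_cutoff_cvg.
- exact: integrable_bound.
- by move=> n; apply: aeW => x _; exact: dot_grad_cutoff_le.
Qed.

Let real_transport n s t : 0 <= s -> s <= t ->
  leb.-integrable `[s, t] (EFin \o flux n) /\
  Phi n t - Phi n s = \int[leb]_(r in `[s, t]) flux n r.
Proof.
move=> s0 st; have t0 := le_trans s0 st.
have [iF EF] := transport _ (test_function_cutoff n.+1%:R (ltr0Sn _ n)) s t s0 st.
have FE r : r \in `[s, t]%classic ->
    (\int[mu r]_x (dot (grad (phi n) x) (u r x))%:E)%E = (flux n r)%:E.
  rewrite inE/= in_itv/= => /andP[sr _]; rewrite /flux /Rintegral fineK//.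
  by apply: integrable_fin_num => //; apply: integrable_flux; exact: le_trans sr.
have iFn : leb.-integrable `[s, t] (EFin \o flux n).
  by apply: eq_integrable iF => // r rst; rewrite FE.
have {}EF : (\int[mu t]_x (phi n x)%:E = \int[mu s]_x (phi n x)%:E +
    \int[leb]_(r in `[s, t]) (flux n r)%:E)%E.
  by rewrite EF; congr (_ + _)%E; apply: eq_integral => r rst; rewrite FE.
split=> //.
apply: EFin_inj; rewrite EFinB /Phi /Rintegral !fineK; last 3 first.
- by apply: integrable_fin_num => //; exact: iFn.
- by apply: integrable_fin_num => //; exact: integrable_phi.
- by apply: integrable_fin_num => //; exact: integrable_phi.
rewrite [X in (X - _)%E]EF addeAC subee ?add0e//.
by apply: integrable_fin_num => //; exact: integrable_phi.
Qed.

Let S_bound T : exists B, forall t, 0 <= t -> t <= T -> S t <= B.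
Proof.
exists (2 * S 0 + 2 * (\int[leb]_(r in `[0, T]) m r) ^+ 2) => t t0 tT.
apply: (le_trans (sqnorm_le_W2 (mu 0) (mu t) (mu2 0 (lexx 0)) (mu2 t t0))).
rewrite lerD2l ler_pM2l// ler_sqr ?nnegrE ?sqrtr_ge0//; last first.
  by apply: Rintegral_ge0 => r _.
rewrite (le_trans (W2_le 0 t (lexx 0) t0))//.
rewrite (Rintegral_itv_chasles 0 t T)// lerDl.
by apply: Rintegral_ge0 => r _.
Qed.

(** The L^2 norm of the velocity is not assumed to be integrable in time, so the
fluxes of the truncations cannot be dominated by it.  The metric speed [m] does
dominate them: the integral of a flux over any interval is the increment of the
truncated moment, which the Wasserstein distance controls. *)
Let flux_bound T : exists C, 0 <= C /\
  forall n, {ae leb, forall r, `[0, T]%classic r -> `|flux n r| <= C * m r}.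
Proof.
have [T0|T0] := ltP T 0.
  exists 0; split=> // n; apply: aeW => r /=; rewrite in_itv/= => /andP[a b].
  by have := le_lt_trans (le_trans a b) T0; rewrite ltxx.
have [B HB] := S_bound T.
exists (Num.sqrt (4 * B)); split=> [|n]; first exact: sqrtr_ge0.
have iF := (real_transport n 0 T (lexx 0) T0).1.
have imC : leb.-integrable `[0, T] (EFin \o (fun r => Num.sqrt (4 * B) * m r)).
  by have := integrableZl _ (Num.sqrt (4 * B)) (im T); apply.
have key s t : 0 <= s -> s <= t -> t <= T ->
    `|\int[leb]_(r in `[s, t]) flux n r| <= \int[leb]_(r in `[s, t]) (Num.sqrt (4 * B) * m r).
  move=> s0 st tT; have t0 := le_trans s0 st.
  rewrite -(real_transport n s t s0 st).2 RintegralZl//; last exact: im_itv.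
  apply: (le_trans (Rintegral_diff_le_W2 (mu s) (mu t) (phi n) (mu2 s s0) (mu2 t t0) _ _ _ _)).
  - exact: measurable_cutoff.
  - by move=> x y; exact: cutoff_lip.
  - exact: integrable_phi.
  - exact: integrable_phi.
  rewrite mulrC ler_pM ?sqrtr_ge0//; last exact: W2_le.
  rewrite ler_wsqrtr//; have := HB s s0 (le_trans st tT); have := HB t t0 tT.
  by rewrite /S; lra.
have h1 := ae_le_of_itv T _ _ iF imC.
have iFN : leb.-integrable `[0, T] (EFin \o (fun r => - flux n r)).
  by have := integrableN iF; exact: eq_integrable.
have h2 := ae_le_of_itv T _ _ iFN imC.
have {}h1 : {ae leb, forall r, r \in `[0, T] -> flux n r <= Num.sqrt (4 * B) * m r}.
  by apply: h1 => s t s0 st tT; apply: le_trans (key s t s0 st tT); exact: ler_norm.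
have {}h2 : {ae leb, forall r, r \in `[0, T] -> - flux n r <= Num.sqrt (4 * B) * m r}.
  apply: h2 => s t s0 st tT; apply: le_trans (key s t s0 st tT).
  rewrite -normrN -mulN1r -RintegralZl//; last exact: (real_transport n s t s0 st).1.
  apply: le_trans (ler_norm _); rewrite le_eqVlt; apply/orP; left; apply/eqP.
  by apply: eq_Rintegral => r _; rewrite mulN1r.
move: h1 h2; apply: filterS2; first exact: (ae_filter_ringOfSetsType leb).
by move=> r a b rT; rewrite ler_norml -lerNl a// b.
Qed.

(** [sqnorm] is not compactly supported, hence not a test function; the identity
is the limit of those for its truncations, by dominated convergence in space for
each fixed time and then in time. *)
Lemma second_moment_derivative s t : 0 <= s -> s <= t ->
  leb.-integrable `[s, t] (EFin \o G) /\
  S t - S s = \int[leb]_(r in `[s, t]) G r.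
Proof.
move=> s0 st; have t0 := le_trans s0 st.
have [C [C0 HC]] := flux_bound t.
have [iG lim] : leb.-integrable `[s, t] (EFin \o G) /\
    \int[leb]_(r in `[s, t]) flux n r @[n --> \oo] --> \int[leb]_(r in `[s, t]) G r.
  apply: (@Rintegral_dominated_cvg _ _ _ leb `[s, t] flux G (fun r => C * m r)) => //.
  - by move=> n; have /integrableP[/measurable_EFinP] := (real_transport n s t s0 st).1.
  - by move=> r /=; rewrite in_itv/= => /andP[sr _]; apply: flux_cvg; exact: le_trans sr.
  - by have := integrableZl _ C (im_itv s t s0); apply.
  - move=> n; have := HC n; apply: filterS; first exact: (ae_filter_ringOfSetsType leb).
    by move=> r H rst; apply: H; exact: sub_itv rst.
split=> //; suff : \int[leb]_(r in `[s, t]) flux n r @[n --> \oo] --> S t - S s.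
  by move=> /(cvg_unique (@Rhausdorff R)); exact.
rewrite (_ : (fun n => _) = (fun n => Phi n t - Phi n s)).
  by apply: cvgB; apply: Phi_cvg.
by apply/funext => n; rewrite (real_transport n s t s0 st).2.
Qed.

End one_species.

(** * A barrier argument *)

(** Where [S] exceeds the bound it cannot grow.  If it exceeded it at time [t],
then after the last time [s] before [t] at which it does not, it would be
nonincreasing up to [t]. *)
Lemma le_max_barrier {R : realType} (S G : R -> R) (K : R) :
  (forall s t, 0 <= s -> s <= t ->
    lebesgue_measure.-integrable `[s, t] (EFin \o G) /\
    S t - S s = \int[lebesgue_measure]_(r in `[s, t]) G r) ->
  (forall r, 0 <= r -> K <= S r -> G r <= 0) ->
  forall t, 0 <= t -> S t <= Num.max (S 0) K.
Proof.
move=> SG G0 t t0; rewrite leNgt; apply/negP => ct.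
set c := Num.max _ _ in ct.
have S0c : S 0 <= c by rewrite le_max lexx.
have Kc : K <= c by rewrite le_max lexx orbT.
pose E := [set r | 0 <= r <= t /\ S r <= c].
have E0 : E 0 by split=> //; rewrite lexx.
have supE : has_sup E by split; [exists 0|exists t => r [/andP[]]].
pose s := sup E.
have s0 : 0 <= s by apply: ub_le_sup => //; exact: supE.2.
have st : s <= t by apply: sup_le_ub; [exists 0|move=> r [/andP[]]].
(* the last time is attained, by left continuity of S *)
have Ssc : S s <= c.
  rewrite leNgt; apply/negP => cs.
  have sp : 0 < s.
    by rewrite lt_neqAle s0 andbT; apply/eqP => s_eq; move: cs; rewrite -s_eq ltNge S0c.
  have lcont : S x @[x --> s^'-] --> S s.
    have := parameterized_integral_continuous s0 (SG 0 s (lexx 0) s0).1.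
    move=> /(continuous_within_itvP _ sp)[_ _ lim].
    have SE x : 0 <= x -> S x = S 0 + parameterized_integral lebesgue_measure 0 x G.
      by move=> x0; rewrite /parameterized_integral -(SG 0 x (lexx 0) x0).2 addrC subrK.
    rewrite (SE s s0); apply: cvg_trans (cvgD (cvg_cst (S 0)) lim).
    apply: near_eq_cvg; near=> x; rewrite (SE x)//.
    by near: x; apply: nbhs_left_ge.
  have [e e0 He] : exists2 e, 0 < e & forall x, s - e < x -> x < s -> c < S x.
    have /= := cvgr_gt _ lcont _ cs.
    move=> [e /= e0 He]; exists e => // x x1 x2; apply: He => //=.
    by rewrite ger0_norm ?subr_ge0 1?ltW// ltrBlDr addrC -ltrBlDr.
  have [r Er] := sup_adherent e0 supE; rewrite -/s => sr.
  have rs : r <= s by apply: ub_le_sup => //; exact: supE.2.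
  have [rs'|rs'] := eqVneq r s.
    by have := Er.2; rewrite rs' leNgt cs.
  have /He : s - e < r by [].
  by rewrite lt_neqAle rs' rs => /(_ isT); rewrite ltNge Er.2.
have above r : s < r -> r <= t -> c < S r.
  move=> sr rt; rewrite ltNge; apply/negP => Src.
  have : r <= s by apply: ub_le_sup; [exact: supE.2|split=> //; rewrite rt (le_trans s0 (ltW sr))].
  by rewrite leNgt sr.
have [iG EG] := SG s t s0 st.
(* S exceeds c only on ]s, t], so the sign of G s is unknown *)
have : S t - S s <= 0.
  rewrite EG -Rintegral_itv_obnd_cbnd; last first.
    by apply: integrableS iG => // r /=; rewrite !in_itv/= => /andP[/ltW-> ->].
  have : 0 <= \int[lebesgue_measure]_(r in `]s, t]) (-1 * G r).
    apply: Rintegral_ge0 => r /=; rewrite in_itv/= => /andP[sr rt].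
    rewrite mulN1r oppr_ge0 G0 ?(le_trans s0 (ltW sr))//.
    exact: le_trans Kc (ltW (above r sr rt)).
  rewrite RintegralZl ?mulN1r ?oppr_ge0//.
  by apply: integrableS iG => // r /=; rewrite !in_itv/= => /andP[/ltW-> ->].
by rewrite subr_le0 leNgt (le_lt_trans Ssc ct).
Unshelve. all: by end_near. Qed.

(** * Monotonicity against the Dirac masses at the origin *)

Lemma Rintegral_sum {R : realType} {d} {X : measurableType d}
  (mu : {measure set X -> \bar R}) (D : set X) (mD : measurable D)
  {n : nat} (f : 'I_n -> X -> R) :
  (forall i, mu.-integrable D (EFin \o f i)) ->
  mu.-integrable D (EFin \o (fun x => \sum_i f i x)) /\
  \int[mu]_(x in D) (\sum_i f i x) = \sum_i \int[mu]_(x in D) f i x.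
Proof.
move=> if_; have E x : (\sum_i (f i x)%:E)%E = (\sum_i f i x)%:E by rewrite sumEFin.
have isum : mu.-integrable D (EFin \o (fun x => \sum_i f i x)).
  have := integrable_sum mD (index_enum 'I_n) (P := predT)
    (h := fun i => EFin \o f i) (fun i _ => if_ i).
  by apply: eq_integrable => // x _; exact: E.
split=> //; apply: EFin_inj; rewrite -sumEFin {1}/Rintegral fineK; last exact: integrable_fin_num.
transitivity (\int[mu]_(x in D) \sum_i (EFin \o f i) x)%E.
  by apply: eq_integral => x _; rewrite -E.
rewrite (integral_sum mD if_); apply: eq_bigr => i _.
by rewrite /Rintegral fineK//; exact: (integrable_fin_num mD (if_ i)).
Qed.

Lemma integral_prodP_sum {R : realType} {n : nat} {disp : 'I_n -> measure_display}
  {T : forall i, measurableType (disp i)} (mu : forall i, probability (T i) R)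
  (g : forall i, T i -> R) :
  (forall i, measurable_fun setT (g i)) ->
  (forall i, (mu i).-integrable setT (EFin \o g i)) ->
  (\int[prodP mu]_z (\sum_i g i (z i))%:E = (\sum_i \int[mu i]_x g i x)%:E)%E.
Proof.
move=> mg ig; have mg' i : measurable_fun setT (EFin \o g i) by exact/measurable_EFinP.
have imarg i : (prodP mu).-integrable setT (EFin \o (fun z : dprod T => g i (z i))).
  exact/(integrable_is_pushforward _ _ _ (@measurable_coor _ _ _ i)
    (prodP_marginal mu i) _ (mg' i)).
have [isum E] := Rintegral_sum (prodP mu) setT measurableT _ imarg.
transitivity (\int[prodP mu]_z (\sum_i g i (z i)))%:E.
  by rewrite /Rintegral fineK//; exact: integrable_fin_num isum.
rewrite E; congr EFin; apply: eq_bigr => i _.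
by rewrite /Rintegral (integral_is_pushforward _ _ _ (@measurable_coor _ _ _ i)
  (prodP_marginal mu i) (EFin \o g i)).
Qed.

Section coupling_with_origin.
Context {R : realType} {k : nat}.
Implicit Types mu : probability 'rV[R]_k R.

Definition pair_origin (x : 'rV[R]_k) : 'rV[R]_k * 'rV[R]_k := (x, 0).

Lemma measurable_pair_origin : measurable_fun setT pair_origin.
Proof. by apply: measurable_fun_pair => //; exact: measurable_cst. Qed.

HB.instance Definition _ :=
  isMeasurableFun.Build _ _ _ _ pair_origin measurable_pair_origin.

Lemma measurable_origin : measurable [set (0 : 'rV[R]_k)].
Proof.
have -> : [set (0 : 'rV[R]_k)] = (@sqnorm R k) @^-1` [set 0].
  by apply/seteqP; split=> x /=; [move=> ->; exact: sqnorm0|exact: sqnorm_eq0].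
by rewrite -[X in measurable X]setTI; exact: measurable_sqnorm.
Qed.

Definition origin_coupling mu : probability ('rV[R]_k * 'rV[R]_k)%type R :=
  distribution mu pair_origin.

Lemma origin_couplingE mu : is_pushforward pair_origin mu (origin_coupling mu).
Proof. by []. Qed.

Lemma coupling_origin mu : coupling mu (dirac (0 : 'rV[R]_k)) (origin_coupling mu).
Proof.
split=> B mB; first by [].
have -> : origin_coupling mu (snd @^-1` B) = mu [set _ | B 0] by [].
rewrite /= diracE; have [B0|B0] := boolP (0 \in B).
  rewrite (_ : [set _ | B 0] = setT) ?probability_setT//.
  by apply/seteqP; split=> // x _; exact: set_mem B0.
rewrite (_ : [set _ | B 0] = set0) ?measure0//.
by apply/seteqP; split=> // x /= /mem_set B0'; rewrite B0' in B0.
Qed.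

(** The second marginal forces the second coordinate to be almost surely 0, so
the cost is the second moment, whatever the coupling; hence all couplings with
the Dirac mass are optimal. *)
Lemma cost_origin mu (gam : probability ('rV[R]_k * 'rV[R]_k)%type R) :
  coupling mu (dirac (0 : 'rV[R]_k)) gam -> cost gam = (\int[mu]_x (sqnorm x)%:E)%E.
Proof.
move=> cgam.
have msq : measurable_fun setT (fun x : 'rV[R]_k => (sqnorm x)%:E).
  by apply/measurable_EFinP; exact: measurable_sqnorm.
rewrite (ge0_integral_is_pushforward _ _ _ measurable_fst cgam.1 _ msq); last first.
  by move=> x; rewrite lee_fin sqnorm_ge0.
apply: ge0_ae_eq_integral => //.
- by apply/measurable_EFinP; exact: measurable_cost.
- by apply/measurable_EFinP; apply: measurable_dot => i; exact: measurable_fst_entry.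
- by move=> z _; rewrite lee_fin sqnorm_ge0.
- by move=> z _; rewrite lee_fin sqnorm_ge0.
exists (snd @^-1` ~` [set 0]); split.
- by rewrite -[X in measurable X]setTI; apply: measurable_snd => //;
    exact: measurableC measurable_origin.
- apply: etrans (esym (cgam.2 _ (measurableC measurable_origin))) _.
  by rewrite /= diracE memNset//= => /(_ erefl).
- move=> z /= H z0; apply: H => _; rewrite z0 subr0//.
Qed.

Lemma optimal_origin mu : optimal_coupling mu (dirac (0 : 'rV[R]_k)) (origin_coupling mu).
Proof.
split=> [|gam' cgam']; first exact: coupling_origin.
by rewrite (cost_origin _ _ cgam') (cost_origin _ _ (coupling_origin mu)).
Qed.

End coupling_with_origin.

Section dissipativity.
Context {R : realType} {n : nat} {d : 'I_n -> nat}.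
Variables (A : forall i, set (probability 'rV[R]_(d i) R)) (lambda : R) (v : velocity (R := R) d).
Hypotheses (lambda_gt0 : 0 < lambda) (A2 : forall i, A i `<=` P2 (k := d i)).
Hypotheses (A0 : in_product A (delta0 (R := R) d)) (v_mono : monotone_velocity lambda v A).
Hypothesis vL2 : forall rho, in_product A rho -> forall i, L2 (rho i) (v rho i).

(** Monotonicity between [rho] and the Dirac masses at the origin, whose coupling
is explicit, controls [dot x (v rho i x - v (delta0 d) i 0)] on average.  Half of
the resulting contraction absorbs the constant field [v (delta0 d) i 0], by
Young's inequality with weight [lambda]. *)
Lemma inward_drift rho : in_product A rho ->
  \sum_i \int[rho i]_x (2 * dot x (v rho i x)) <=
  lambda^-1 * \sum_i sqnorm (v (delta0 d) i 0) - lambda * \sum_i \int[rho i]_x sqnorm x.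
Proof.
move=> Arho.
pose v0 i : 'rV[R]_(d i) := v (delta0 d) i 0.
pose gam i := origin_coupling (rho i).
have gE i := origin_couplingE (rho i).
have mpo i := @measurable_pair_origin R (d i).
have rho2 i : P2 (rho i) by exact: A2.
have isq i := integrable_sqnorm _ (rho2 i).
have iv i : (rho i).-integrable setT (fun x => (sqnorm (v rho i x))%:E).
  have [mv v2] := vL2 rho Arho i.
  apply: integrable_EFin_ge0 => // [|x]; last exact: sqnorm_ge0.
  by apply: measurable_dot => j; exact: measurable_entry.
have mx i j : measurable_fun setT (fun x : 'rV[R]_(d i) => x 0 j) by exact: measurable_coord.
have mv i j : measurable_fun setT (fun x => v rho i x 0 j).
  by apply: measurable_entry; exact: (vL2 rho Arho i).1.
have idot i : (rho i).-integrable setT (EFin \o (fun x => dot x (v rho i x))).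
  exact: (integrable_dot _ (fun x => x) (v rho i) (mx i) (mv i) (isq i) (iv i)).
have ic i : (rho i).-integrable setT (fun=> (sqnorm (v0 i))%:E).
  exact: finite_measure_integrable_cst.
have idot0 i : (rho i).-integrable setT (EFin \o (fun x => dot x (v0 i))).
  apply: (integrable_dot _ (fun x => x) (fun=> v0 i) (mx i) _ (isq i) (ic i)) => j.
  exact: measurable_cst.
have mono := v_mono _ _ Arho A0 gam (fun i => optimal_origin (rho i)).
have E1 : (\int[prodP gam]_z (\sum_i sqnorm ((z i).1 - (z i).2))%:E =
    (\sum_i \int[rho i]_x sqnorm x)%:E)%E.
  rewrite (integral_prodP_sum gam (fun i z => sqnorm (z.1 - z.2))).
  - congr EFin; apply: eq_bigr => i _; rewrite /Rintegral; congr fine.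
    exact: cost_origin _ _ (coupling_origin (rho i)).
  - by move=> i; exact: measurable_cost.
  - move=> i; apply/(integrable_is_pushforward _ _ _ (mpo i) (gE i)).
      by apply/measurable_EFinP; exact: measurable_cost.
    by apply: eq_integrable (isq i) => // x _; rewrite /= subr0.
pose w i (z : 'rV[R]_(d i) * 'rV[R]_(d i)) :=
  dot (z.1 - z.2) (v rho i z.1 - v (delta0 d) i z.2).
have mw i : measurable_fun setT (w i).
  have m0 j : measurable_fun setT (fun x => v (delta0 d) i x 0 j).
    by apply: measurable_entry; exact: (vL2 _ A0 i).1.
  apply: measurable_dot => j; under eq_fun do rewrite !mxE; apply: measurable_funB.
  - exact: measurable_fst_entry.
  - exact: measurable_snd_entry.
  - exact: (measurableT_comp (mv i j) measurable_fst).
  - exact: (measurableT_comp (m0 j) measurable_snd).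
have iw' i : (rho i).-integrable setT (EFin \o (fun x => w i (x, 0))).
  have := integrable_lin _ 1 (- 1) _ _ (idot i) (idot0 i).
  by apply: eq_integrable => // x _; rewrite /w /= subr0 dotDr dotNr mul1r mulN1r.
have E2 : (\int[prodP gam]_z (\sum_i w i (z i))%:E =
    (\sum_i \int[rho i]_x w i (x, 0%R))%:E)%E.
  have iw i : (gam i).-integrable setT (EFin \o w i).
    apply/(integrable_is_pushforward _ _ _ (mpo i) (gE i)).
      by apply/measurable_EFinP; exact: mw.
    exact: iw'.
  rewrite (integral_prodP_sum gam w mw iw).
  congr EFin; apply: eq_bigr => i _; rewrite /Rintegral.
  rewrite (integral_is_pushforward _ _ _ (mpo i) (gE i) (EFin \o w i))//.
    by apply/measurable_EFinP; exact: mw.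
  exact: iw.
rewrite -/gam in mono; move: mono; rewrite E1 E2 -EFinM -EFinN lee_fin => mono.
have low i : \int[rho i]_x (2 * dot x (v rho i x)) - lambda * \int[rho i]_x sqnorm x -
    lambda^-1 * sqnorm (v0 i) <= 2 * \int[rho i]_x w i (x, 0).
  have iw2 : (rho i).-integrable setT (EFin \o (fun x => 2 * w i (x, 0))).
    by have := integrableZl measurableT 2 (iw' i); exact: eq_integrable.
  have il := integrable_lin _ 1 (- 1) _ _ (integrable_lin _ 2 (- lambda) _ _ (idot i) (isq i))
    (integrable_lin _ lambda^-1 0 _ _ (ic i) (ic i)).
  have lhs : \int[rho i]_x (1 * (2 * dot x (v rho i x) + - lambda * sqnorm x) +
      - 1 * (lambda^-1 * sqnorm (v0 i) + 0 * sqnorm (v0 i))) <= \int[rho i]_x (2 * w i (x, 0)).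
    apply: le_Rintegral => // x _.
    rewrite /w /= subr0 dotDr dotNr -/(v0 i).
    have := dot_young lambda x (v0 i) lambda_gt0.
    by have := ler_norm (dot x (v0 i)); lra.
  rewrite -(RintegralZl 2 measurableT (iw' i)); apply: le_trans lhs.
  rewrite Rintegral_lin//; [|exact: integrable_lin..].
  rewrite Rintegral_lin// (Rintegral_lin _ lambda^-1 0)//.
  have -> : \int[rho i]_x sqnorm (v0 i) = sqnorm (v0 i).
    by rewrite Rintegral_cst//; rewrite [X in fine X](@probability_setT _ _ _ (rho i)) mulr1.
  rewrite RintegralZl//.
  lra.
have : \sum_i (\int[rho i]_x (2 * dot x (v rho i x)) - lambda * \int[rho i]_x sqnorm x -
    lambda^-1 * sqnorm (v0 i)) <= \sum_i (2 * \int[rho i]_x w i (x, 0)).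
  by apply: ler_sum => i _; exact: low.
rewrite !sumrB -!mulr_sumr; rewrite /v0; lra.
Qed.

End dissipativity.

(** * Boundedness of the second moments *)

Theorem lemma3p5 (R : realType) (n : nat) (hn : (0 < n)%N) (d : 'I_n -> nat)
  (A : forall i, set (probability 'rV[R]_(d i) R))
  (hA : forall i, A i `<=` P2 (k := d i))
  (A_convex : geodesically_convex A)
  (A_delta0 : in_product A (delta0 (R := R) d))
  (lambda : R) (lambda_gt0 : 0 < lambda)
  (v : velocity d) (v_monotone : monotone_velocity lambda v A)
  (fv : first_variations d)
  (h_diff : forall rho, in_product A rho -> J_well_defined A v fv rho)
  (h_cont : J_continuous A v fv)
  (h_adm : forall rho, in_product A rho ->
     forall i, admissible (rho i) (A i) (v rho i))
  (rho : R -> state d)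
  (rho_in : forall t, 0 <= t -> in_product A (rho t))
  (rho_sol : continuity_equation v rho)
  (h_v0 : ((Num.sqrt (\sum_i sqnorm (v (delta0 d) i 0)))%:E < +oo)%E)
  (h_D : (dissipation v (rho 0%R) < +oo)%E)
  (h_grad : forall mu, in_product A mu ->
     forall i, grad_Loo_loc (v mu i)) :
  exists c : R, 0 <= c /\
    forall t, 0 <= t -> (second_moment (rho t) <= c%:E)%E.
Proof.
have [[m [m_ge0 im Wm]] transport] := rho_sol.
have vL2 mu : in_product A mu -> forall i, L2 (mu i) (v mu i).
  by move=> Amu i; have [] := h_adm mu Amu i.
have W2m i s t : 0 <= s -> s <= t -> W2 (rho s i) (rho t i) <=
    \int[lebesgue_measure]_(r in `[s, t]) m r.
  move=> s0 st; have ist : lebesgue_measure.-integrable `[s, t] (EFin \o m).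
    apply: integrableS (im t) => // r /=; rewrite !in_itv/= => /andP[sr ->].
    by rewrite (le_trans s0 sr).
  rewrite -lee_fin fineK; last exact: integrable_fin_num ist.
  apply: le_trans (Wm s t s0 st); rewrite lee_fin /Wbar.
  rewrite -[leLHS]ger0_norm ?sqrtr_ge0// -sqrtr_sqr ler_wsqrtr// (bigD1 i)//= lerDl.
  by apply: sumr_ge0 => j _; exact: sqr_ge0.
pose S t := \sum_i \int[rho t i]_x sqnorm x.
pose G t := \sum_i \int[rho t i]_x (2 * dot x (v (rho t) i x)).
have SG s t : 0 <= s -> s <= t ->
    lebesgue_measure.-integrable `[s, t] (EFin \o G) /\
    S t - S s = \int[lebesgue_measure]_(r in `[s, t]) G r.
  move=> s0 st.
  have H i := @second_moment_derivative R (d i) (fun t => rho t i) (fun t => v (rho t) i) m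
    (fun t t0 => hA i _ (rho_in t t0 i)) (fun t t0 => vL2 _ (rho_in t t0) i) m_ge0 im
    (W2m i) (transport i) s t s0 st.
  have [iG ->] := Rintegral_sum lebesgue_measure `[s, t]%classic (measurable_itv _) _
    (fun i => (H i).1).
  split; first exact: iG.
  by rewrite -sumrB; apply: eq_bigr => i _; exact: (H i).2.
pose K := lambda^-2 * \sum_i sqnorm (v (delta0 d) i 0).
have GK r : 0 <= r -> K <= S r -> G r <= 0.
  move=> r0 KS; apply: le_trans (inward_drift A lambda v lambda_gt0 hA A_delta0
    v_monotone vL2 _ (rho_in r r0)) _.
  rewrite subr_le0 -ler_pdivrMl// mulrA -expr2 exprVn; exact: KS.
have S_ge0 t : 0 <= S t.
  by apply: sumr_ge0 => i _; apply: Rintegral_ge0 => x _; exact: sqnorm_ge0.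
exists (2^-1 * Num.max (S 0) K); split.
  by rewrite mulr_ge0 ?invr_ge0// le_max S_ge0.
move=> t t0; rewrite /second_moment.
have -> : (\sum_i \int[rho t i]_x (sqnorm x)%:E = (S t)%:E)%E.
  rewrite /S -sumEFin; apply: eq_bigr => i _; rewrite /Rintegral fineK//.
  by apply: integrable_fin_num => //; apply: integrable_sqnorm; exact: hA _ (rho_in t t0 i).
by rewrite -EFinM lee_fin ler_pM2l ?invr_gt0// (le_max_barrier S G K SG GK t t0).
Qed.
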